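(* Let $\mu$ be a measure on $\mathbb{R}$ with compact support $E$ with $C(E)>0$, with Jacobi parameters $\{a_n,b_n\}_{n\ge1}$. Let $n(1)<n(2)<\cdots$ be a subsequence such that the zero counting measures $\nu_{n(j)}$ of the orthonormal polynomials $p_{n(j)}$ converge weakly to $\rho_E$, the equilibrium measure of $E$. Then either (a) $\lim_{j\to\infty}(a_1\cdots a_{n(j)})^{1/n(j)}=C(E)$, or (b) there is a Borel set $X\subset E$ with $C(X)=0$ and $\mu(\mathbb{R}\setminus X)=0$.
   Context: Capacity: for compact $K\subset\mathbb{C}$, $C(K)=\exp(-\inf\{\iint\log|x-y|^{-1}d\nu(x)d\nu(y):\nu \text{ probability on } K\})$; for Borel $X$, $C(X)=\sup\{C(K):K\subset X\text{ compact}\}$. If $C(K)>0$, $\rho_K$ is the unique probability measure on $K$ attaining the infimum. Jacobi parameters: the orthonormal polynomials obey $xp_n=a_{n+1}p_{n+1}+b_{n+1}p_n+a_np_{n-1}$ with $a_n>0$. The zero counting measure of $p_n$ is $\frac1n\sum\delta_{z_j}$ over its zeros with multiplicity. *)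

(* Defs.v *)
From HB Require Import structures.
From mathcomp Require Import all_boot all_order all_algebra.
From mathcomp Require Import all_classical all_reals all_analysis.
Set Implicit Arguments. Unset Strict Implicit. Unset Printing Implicit Defensive.
Import Order.TTheory GRing.Theory Num.Theory.
Import numFieldNormedType.Exports.
Local Open Scope classical_set_scope.
Local Open Scope ring_scope.

Section Defs.
Variable R : realType.

Definition logker (x y : R) : \bar R :=
  if x == y then +oo%E else (- ln `|x - y|)%:E.

Definition log_energy (nu : set R -> \bar R) : \bar R :=
  (\int[nu]_x \int[nu]_y logker x y)%E.

Definition prob_on (K : set R) (nu : probability R R) : Prop := nu (~` K) = 0%E.

Definition min_energy (K : set R) : \bar R :=
  ereal_inf [set log_energy nu | nu in prob_on K].

Definition cap_compact (K : set R) : \bar R :=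
  match min_energy K with
  | r%:E => (expR (- r))%:E
  | +oo%E => 0%E
  | -oo%E => +oo%E
  end.

Definition capacity (X : set R) : \bar R :=
  ereal_sup [set cap_compact K | K in [set K | compact K /\ K `<=` X]].

Definition equilibrium (K : set R) (rho : probability R R) : Prop :=
  prob_on K rho /\ log_energy rho = min_energy K.

Definition msupport (mu : set R -> \bar R) : set R :=
  [set x | forall U, open U -> U x -> (0 < mu U)%E].

Definition orthonormal_polys (mu : set R -> \bar R) (p : nat -> {poly R}) : Prop :=
  (forall n, size (p n) = n.+1) /\
  (forall n, 0 < lead_coef (p n)) /\
  (forall n m, (\int[mu]_x ((p n).[x] * (p m).[x])%:E = (n == m)%:R%:E)%E).

(* a, b are the Jacobi parameters (indices >= 1; a 0, b 0 unused) of p *)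
Definition jacobi_params (p : nat -> {poly R}) (a b : nat -> R) : Prop :=
  (forall n, (0 < n)%N -> 0 < a n) /\
  (forall n, 'X * p n =
     a n.+1 *: p n.+1 + b n.+1 *: p n + (if n is k.+1 then a n *: p k else 0)).

(* integral of f against the zero counting measure of p:
   (1/deg p) * sum over zeros x of p, counted with multiplicity, of f x *)
Definition zero_count_int (p : {poly R}) (f : R -> R) : R :=
  ((size p).-1%:R)^-1 * (\sum_(x \in [set x | root p x]) (mup x p)%:R * f x)%R.

Definition zeros_weak_cvg (q : nat -> {poly R}) (rho : set R -> \bar R) : Prop :=
  forall f : R -> R, continuous f -> (exists M, forall x, `|f x| <= M) ->
    (fun j => (zero_count_int (q j) f)%:E) @ \oo --> (\int[rho]_x (f x)%:E)%E.

End Defs.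

(* Main.v *)
Require Import Defs.
From HB Require Import structures.
From mathcomp Require Import all_boot all_order all_algebra.
From mathcomp Require Import all_classical all_reals all_analysis.
From mathcomp Require Import measurable_realfun.
From mathcomp Require Import ring lra.
Import Order.TTheory GRing.Theory Num.Theory.
Import numFieldNormedType.Exports.
Local Open Scope classical_set_scope.
Local Open Scope ring_scope.

Set Implicit Arguments. Unset Strict Implicit.

(* Write [I] for the minimal energy of [E], so that [C(E) = exp(-I)], and [w_n] for
   [a_1 ... a_n], which is the ratio of the leading coefficients of [p_0] and [p_n].

   Upper bound. [1 / lead(p_n)] is the minimal L2 norm of a monic polynomial of degree [n],
   so [limsup w_n^(1/n) <= c] as soon as some monic [Q] satisfies [|Q| < c^(deg Q)] on [E].
   Such a [Q] exists for every [c > C(E)]: otherwise one chooses [x_n] in [E] inductively with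
   [prod_(i < n) |x_n - x_i| >= c^n], and a limit of the empirical measures of this sequence
   is a probability on [E] of energy at most [- ln c < I].

   Lower bound. If [w_n(j)^(1/n(j)) <= B < C(E)] for infinitely many [j], the Borel-Cantelli
   lemma gives a set [X] of full measure on which [|p_n(j)|^(1/n(j))] is eventually at most
   some [t] with [t B < C(E)] along these [j]. A measure of finite energy on [X] can be
   restricted to a closed set of positive mass on which these bounds are uniform and its
   potential is the uniform limit of truncated, hence continuous, potentials. Integrating
   this potential against the zero counting measures of [p_n(j)], which converge to [rho],
   contradicts Frostman's bound on the potential of [rho]. Hence [X] has capacity zero. *)

(** * The logarithmic kernel and its truncations *)

(** The logarithmic kernel changes sign and is infinite on the diagonal, so Tonelli and monotone
    convergence do not apply to it directly. Adding a bound [M] for the logarithm of the diameter of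
    [E] makes it nonnegative on [E] and shifts the energy of every probability on [E] by [M]; the
    positive part extends this to the whole line. The extension matters: zeros of [p n] may fall in
    gaps of [E], so a bound on a potential known only on [E] is of no use at them. The maximum
    principle carries such bounds to all points. It serves twice, for Frostman's bound and for the
    uniform error between a potential and its truncation, the latter being bounded and continuous
    and therefore a legitimate test function for the weak convergence. *)

Section Kernel.
Variable R : realType.
Implicit Types M r x y : R.

(* [lk M] is the positive part of [M + log (1 / |x - y|)]: on a set of diameter at most
   [exp M] it is a nonnegative kernel whose energy is the logarithmic one up to [M].
   [trker M r] is the continuous kernel obtained by replacing [|x - y|] with
   [max r |x - y|]. *)
Definition trker M r x y : R := Num.max 0 (M - ln (Num.max r `|x - y|)).

Definition lk M x y : \bar R := maxe 0%E (M%:E + logker x y)%E.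

Lemma lk_ge0 M x y : (0 <= lk M x y)%E.
Proof. by rewrite /lk le_max lexx. Qed.

Lemma logkerC x y : logker x y = logker y x.
Proof. by rewrite /logker eq_sym distrC. Qed.

Lemma lkC M x y : lk M x y = lk M y x.
Proof. by rewrite /lk logkerC. Qed.

Lemma lk_diag M x : lk M x x = +oo%E.
Proof. by rewrite /lk /logker eqxx addey// maxey. Qed.

Lemma lk_neq M x y : x != y -> lk M x y = (Num.max 0 (M - ln `|x - y|))%:E.
Proof. by move=> /negbTE xy; rewrite /lk /logker xy EFin_max EFinD EFinN. Qed.

Lemma lkE M x y : `|x - y| <= expR M -> lk M x y = (M%:E + logker x y)%E.
Proof.
have [->|xy] := eqVneq x y; first by rewrite lk_diag /logker eqxx addey.
move=> h; rewrite lk_neq// /logker (negbTE xy) -EFinD max_r// subr_ge0.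
by rewrite -(@ler_expR R) lnK// posrE normr_gt0 subr_eq0.
Qed.

Lemma trker_ge0 M r x y : 0 <= trker M r x y.
Proof. by rewrite /trker le_max lexx. Qed.

Lemma trkerC M r x y : trker M r x y = trker M r y x.
Proof. by rewrite /trker distrC. Qed.

Lemma trker_le_ln M r s x y : 0 < s -> s <= Num.max r `|x - y| ->
  trker M r x y <= Num.max 0 (M - ln s).
Proof.
move=> s0 sr; rewrite /trker ge_max le_max lexx/= le_max; apply/orP; right.
by rewrite lerB// ler_ln// posrE// (lt_le_trans s0).
Qed.

Lemma trker_le M r x y : 0 < r -> trker M r x y <= Num.max 0 (M - ln r).
Proof. by move=> r0; apply: trker_le_ln => //; rewrite le_max lexx. Qed.

Lemma trker_le_lk M r x y : 0 < r -> ((trker M r x y)%:E <= lk M x y)%E.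
Proof.
move=> r0; have [->|xy] := eqVneq x y; first by rewrite lk_diag leey.
rewrite lk_neq// lee_fin; apply: trker_le_ln; last by rewrite le_max lexx orbT.
by rewrite normr_gt0 subr_eq0.
Qed.

(** [lk (ln r)] is the positive part of [log (r / |x - y|)]: it vanishes for [|x - y| >= r] and
    gives back what replacing [|x - y|] by [r] removes. Smallness of its potential will measure the
    error of truncation. *)
Lemma lk_le_trker M r x y : 0 < r ->
  (lk M x y <= (trker M r x y)%:E + lk (ln r) x y)%E.
Proof.
move=> r0; have [->|xy] := eqVneq x y.
  by rewrite !lk_diag addey// leey.
rewrite !lk_neq// -EFinD lee_fin.
have d0 : 0 < `|x - y| by rewrite normr_gt0 subr_eq0.
rewrite /trker; have [h|h] := leP r `|x - y|.
  by rewrite lerDl le_max lexx.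
rewrite ge_max; apply/andP; split; first by rewrite addr_ge0// le_max lexx.
apply: (@le_trans _ _ ((M - ln r) + (ln r - ln `|x - y|))).
  by rewrite addrA subrK.
by rewrite lerD// le_max lexx orbT.
Qed.

Lemma trker_decr M r r' x y : 0 < r -> r <= r' -> trker M r' x y <= trker M r x y.
Proof.
move=> r0 rr; rewrite [leRHS]/trker; apply: trker_le_ln.
  by rewrite lt_max r0.
by rewrite ge_max !le_max rr lexx orbT.
Qed.

(** A truncated distance is at least [r], so decreasing it by at most [d] keeps at least the
    fraction [1 - d / r] of it. The logarithm turns this into an additive error that does not depend
    on the points. *)
Lemma trker_unif M r d x y x' y' : 0 < d < r ->
  `| `|x - y| - `|x' - y'| | <= d ->
  trker M r x y <= trker M r x' y' - ln (1 - d / r).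
Proof.
move=> /andP[d0 dr] h; have r0 : 0 < r by exact: lt_trans dr.
have q0 : 0 < 1 - d / r by rewrite subr_gt0 ltr_pdivrMr// mul1r.
have q1 : ln (1 - d / r) <= 0 by rewrite ln_le0// gerBl divr_ge0// ltW.
have t0 : 0 < Num.max r `|x - y| by rewrite lt_max r0.
have t'0 : 0 < Num.max r `|x' - y'| by rewrite lt_max r0.
rewrite {1}/trker ge_max; apply/andP; split.
  by rewrite subr_ge0 (le_trans q1)// trker_ge0.
rewrite {1}/trker.
have key : Num.max r `|x' - y'| * (1 - d / r) <= Num.max r `|x - y|.
  rewrite mulrBr mulr1; set t' := Num.max r _.
  have h1 : d <= t' * (d / r).
    rewrite mulrA ler_pdivlMr// mulrC ler_pM2r//.
    by rewrite /t' le_max lexx.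
  rewrite lerBlDr; apply: (@le_trans _ _ (Num.max r `|x - y| + d)); last by rewrite lerD2l.
  have {h} h : `|x' - y'| - `|x - y| <= d by rewrite (le_trans (ler_norm _))// distrC.
  rewrite /t' ge_max; apply/andP; split.
    by rewrite ler_wpDr ?(ltW d0)// le_max lexx.
  rewrite -lerBlDr (@le_trans _ _ `|x - y|)//; last by rewrite le_max lexx orbT.
  by lra.
apply: (@le_trans _ _ (M - ln (Num.max r `|x' - y'| * (1 - d / r)))).
  by rewrite lerB// ler_ln// posrE mulr_gt0.
by rewrite lnM ?posrE// opprD addrA lerD2r le_max lexx orbT.
Qed.

Lemma lk_dist M x y x' y' : `|x' - y'| <= `|x - y| -> (lk M x y <= lk M x' y')%E.
Proof.
have [->|xy'] := eqVneq x' y'; first by rewrite lk_diag leey.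
have d0 : 0 < `|x' - y'| by rewrite normr_gt0 subr_eq0.
move=> h; have xy : x != y by rewrite -subr_eq0 -normr_gt0 (lt_le_trans d0).
rewrite !lk_neq// lee_fin ge_max !le_max lexx/=; apply/orP; right.
by rewrite lerB// ler_ln// posrE// (lt_le_trans d0).
Qed.

Lemma ln_concave (t a b : R) : 0 <= t <= 1 -> 0 < a -> 0 < b ->
  t * ln a + (1 - t) * ln b <= ln (t * a + (1 - t) * b).
Proof.
move=> /andP[t0 t1] a0 b0.
pose t' := Itv01 t0 t1.
by have := @concave_ln R t' a b a0 b0; rewrite !convRE.
Qed.

(** [|x - y|] is affine in [x] on either side of [y], [- ln] is convex, and taking the positive part
    preserves convexity. When [y] is an end point the right side is infinite. *)
Lemma lk_convex M (t c d y : R) : 0 < t < 1 -> c < d -> (y <= c) || (d <= y) ->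
  (lk M (t * c + (1 - t) * d) y <= t%:E * lk M c y + (1 - t)%:E * lk M d y)%E.
Proof.
move=> /andP[t0 t1] cd ycd.
have s0 : 0 < 1 - t by rewrite subr_gt0.
have [->|cy] := eqVneq c y.
  by rewrite lk_diag gt0_muley ?lte_fin// addye ?leey// gt_eqF// (lt_le_trans (ltNyr 0))//
     mule_ge0 ?lk_ge0// lee_fin ltW.
have [->|dy] := eqVneq d y.
  rewrite lk_diag [X in (_ + X)%E]gt0_muley ?lte_fin// addey ?leey// gt_eqF//.
  by rewrite (lt_le_trans (ltNyr 0))// mule_ge0 ?lk_ge0// lee_fin ltW.
have xy : `|t * c + (1 - t) * d - y| = t * `|c - y| + (1 - t) * `|d - y|.
  case/orP: ycd => h.
    rewrite !ger0_norm; [ring|lra|lra|].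
    rewrite (_ : _ - y = t * (c - y) + (1 - t) * (d - y)); last by ring.
    by rewrite addr_ge0// mulr_ge0//; lra.
  rewrite !ler0_norm; [ring|lra|lra|].
  rewrite (_ : _ - y = - (t * (y - c) + (1 - t) * (y - d))); last by ring.
  by rewrite oppr_le0 addr_ge0// mulr_ge0//; lra.
have c0 : 0 < `|c - y| by rewrite normr_gt0 subr_eq0.
have d0 : 0 < `|d - y| by rewrite normr_gt0 subr_eq0.
have x0 : t * c + (1 - t) * d != y.
  by rewrite -subr_eq0 -normr_gt0 xy addr_gt0// mulr_gt0.
rewrite !lk_neq// -!EFinM -EFinD lee_fin xy ge_max; apply/andP; split.
  by rewrite addr_ge0// mulr_ge0 ?le_max ?lexx// ltW.
apply: (@le_trans _ _ (t * (M - ln `|c - y|) + (1 - t) * (M - ln `|d - y|))).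
  have := @ln_concave t `|c - y| `|d - y|; rewrite (ltW t0) (ltW t1) => /(_ isT c0 d0).
  by lra.
by rewrite lerD// ler_wpM2l ?le_max ?lexx ?orbT// ltW.
Qed.

Lemma trker_cvg M x y :
  (fun n => (trker M n.+1%:R^-1 x y)%:E) @ \oo --> lk M x y.
Proof.
have [<-|xy] := eqVneq x y.
  rewrite lk_diag; apply/cvgeryP/cvgryPge => A.
  near=> n.
  have n1 : (0:R) < n.+1%:R^-1 by rewrite invr_gt0.
  rewrite /trker subrr normr0 (max_l (ltW n1)) lnV ?posrE// opprK le_max; apply/orP; right.
  rewrite -lerBlDl -ler_expR lnK ?posrE//.
  apply: (@le_trans _ _ n%:R); last by rewrite ler_nat.
  by near: n; exact: nbhs_infty_ger.
rewrite lk_neq//; apply/cvg_EFin; first by near=> n.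
apply: (@cvg_near_cst _ _ _ _ _ _) => //.
have d0 : 0 < `|x - y| by rewrite normr_gt0 subr_eq0.
near=> n; rewrite /trker /= [Num.max n.+1%:R^-1 _]max_r//.
rewrite -[leRHS]invrK lef_pV2 ?posrE ?invr_gt0//.
apply: (@le_trans _ _ n%:R); last by rewrite ler_nat.
by near: n; exact: nbhs_infty_ger.
Unshelve. all: by end_near. Qed.

Lemma measurable_trker M r : 0 < r ->
  measurable_fun [set: R * R] (fun z : R * R => trker M r z.1 z.2).
Proof.
move=> r0; apply: (@measurable_maxr _ _ _ _ (cst 0)
  (fun z : R * R => M - ln (Num.max r `|z.1 - z.2|))) => //.
apply: measurable_funB => //; apply: measurableT_comp; first exact: measurable_ln.
apply: (@measurable_maxr _ _ _ _ (cst r)) => //; apply: measurableT_comp => //.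
exact: measurable_funB.
Qed.

Lemma measurable_lk M :
  measurable_fun [set: R * R] (fun z : R * R => lk M z.1 z.2).
Proof.
apply: (emeasurable_fun_cvg (fun n (z : R * R) => (trker M n.+1%:R^-1 z.1 z.2)%:E)).
  by move=> n; apply/measurable_EFinP; apply: measurable_trker; rewrite invr_gt0.
by move=> z _; exact: trker_cvg.
Qed.

Lemma measurable_lk1 M x : measurable_fun [set: R] (lk M x).
Proof. exact: (measurable_fun_pair2 x (measurable_lk M)). Qed.

Lemma measurable_trker1 M r x : 0 < r -> measurable_fun [set: R] (trker M r x).
Proof. by move=> r0; exact: (measurable_fun_pair2 x (@measurable_trker M r r0)). Qed.

Lemma measurable_trkerE M r x : 0 < r ->
  measurable_fun [set: R] (fun y => (trker M r x y)%:E).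
Proof. by move=> r0; apply/measurable_EFinP; exact: measurable_trker1. Qed.

End Kernel.

(** * Potentials *)

Section Restriction.
Context d (T : measurableType d) (R : realType).
Implicit Types s t : {finite_measure set T -> \bar R}.

Lemma restrict_measure s (F : set T) : measurable F ->
  exists t : {finite_measure set T -> \bar R}, forall A, t A = s (A `&` F).
Proof.
move=> mF; have h : (s F < +oo)%E by rewrite ltey_eq fin_num_measure.
by exists (mfrestr mF h).
Qed.

Lemma integral_restrict s t (F : set T) (f : T -> \bar R) : measurable F ->
  (forall A, t A = s (A `&` F)) -> measurable_fun setT f ->
  (forall x, 0 <= f x)%E ->
  (\int[t]_x f x = \int[s]_(x in F) f x)%E.
Proof.
move=> mF tE mf f0.
rewrite (@ge0_negligible_integral _ _ _ t setT (~` F))//; last 2 first.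
- exact: measurableC.
- by have := tE (~` F); rewrite setICl measure0.
rewrite setTD setCK; apply: eq_measure_integral => A mA AF.
by rewrite /= tE setIidl.
Qed.

Lemma integral_concentrated (s : {measure set T -> \bar R}) (S : set T) (f : T -> \bar R) :
  measurable S -> s (~` S) = 0%E -> measurable_fun setT f ->
  (forall x, 0 <= f x)%E ->
  (\int[s]_x f x = \int[s]_(x in S) f x)%E.
Proof.
move=> mS s0 mf f0.
rewrite (@ge0_negligible_integral _ _ _ s setT (~` S))//; last exact: measurableC.
by rewrite setTD setCK.
Qed.

End Restriction.

Section Potential.
Variable R : realType.
Implicit Types (M r x y : R) (s t : {finite_measure set R -> \bar R}).

Definition pot M (s : set R -> \bar R) x : \bar R := (\int[s]_y lk M x y)%E.

Definition tpot M r (s : set R -> \bar R) x : \bar R := (\int[s]_y (trker M r x y)%:E)%E.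

Lemma pot_ge0 M s x : (0 <= pot M s x)%E.
Proof. by apply: integral_ge0 => y _; exact: lk_ge0. Qed.

Lemma measurable_pot M s : measurable_fun [set: R] (pot M s).
Proof.
apply: (measurable_fun_fubini_tonelli_F (fun z : R * R => lk M z.1 z.2)).
  exact: measurable_lk.
by move=> z; exact: lk_ge0.
Qed.

Lemma pot_sym M s t : (\int[s]_x pot M t x = \int[t]_x pot M s x)%E.
Proof.
have -> := fubini_tonelli (fun z : R * R => lk M z.1 z.2) (measurable_lk M)
  (fun z => lk_ge0 _ _ _) (m1 := s) (m2 := t).
by apply: eq_integral => y _; apply: eq_integral => x _ /=; rewrite lkC.
Qed.

Lemma tpot_ge0 M r s x : (0 <= tpot M r s x)%E.
Proof. by apply: integral_ge0 => y _; rewrite lee_fin trker_ge0. Qed.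

Lemma tpot_le M r s x : 0 < r ->
  (tpot M r s x <= (Num.max 0 (M - ln r))%:E * s setT)%E.
Proof.
move=> r0; rewrite -integral_cst//; apply: ge0_le_integral => //.
- by move=> y _; rewrite lee_fin trker_ge0.
- exact: measurable_trkerE.
- by move=> y _; rewrite lee_fin trker_le.
Qed.

Lemma tpot_fin M r s x : 0 < r -> tpot M r s x \is a fin_num.
Proof.
move=> r0; rewrite ge0_fin_numE ?tpot_ge0//.
apply: (le_lt_trans (tpot_le M s x r0)).
by rewrite ltey_eq fin_numM// fin_num_measure.
Qed.

Lemma tpot_unif M r d s x x' : 0 < d < r -> `|x - x'| <= d ->
  (tpot M r s x <= tpot M r s x' + (- ln (1 - d / r))%:E * s setT)%E.
Proof.
move=> /[dup] dr /andP[d0 dr'] h; have r0 : 0 < r by exact: lt_trans dr'.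
have q0 : 0 < 1 - d / r by rewrite subr_gt0 ltr_pdivrMr// mul1r.
have q1 : 0 <= - ln (1 - d / r) by rewrite oppr_ge0 ln_le0// gerBl divr_ge0// ltW.
rewrite -integral_cst// -[leRHS]ge0_integralD//=; first last.
- exact: measurable_trkerE.
- by move=> y _; rewrite lee_fin trker_ge0.
apply: ge0_le_integral => //.
- by move=> y _; rewrite lee_fin trker_ge0.
- exact: measurable_trkerE.
- apply: emeasurable_funD => //; exact: measurable_trkerE.
move=> y _; rewrite -EFinD lee_fin; apply: trker_unif => //.
apply: le_trans h; apply: (le_trans (ler_dist_dist _ _)).
by rewrite opprB addrA subrK.
Qed.

Lemma continuous_tpot M r s : 0 < r -> continuous (fun x => fine (tpot M r s x)).
Proof.
move=> r0 x; apply/cvgrPdist_le => e e0.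
pose K := fine (s setT).
have K0 : 0 <= K by rewrite fine_ge0.
have sK : s setT = K%:E by rewrite fineK// fin_num_measure.
(* Solves [- ln (1 - d / r) = e / (K + 1)]; the [+ 1] covers a measure of total mass zero. *)
pose d := r * (1 - expR (- (e / (K + 1)))).
have eK : 0 < e / (K + 1) by rewrite divr_gt0// ltr_wpDl.
have d0 : 0 < d < r.
  rewrite /d mulr_gt0 ?subr_gt0 ?expR_lt1 ?oppr_lt0//=.
  by rewrite gtr_pMr// gtrBl expR_gt0.
have dE : - ln (1 - d / r) = e / (K + 1).
  rewrite /d mulrAC divff ?gt_eqF// mul1r opprB addrC subrK expRK opprK//.
have key y y' : `|y - y'| <= d -> fine (tpot M r s y) <= fine (tpot M r s y') + e.
  move=> h; have := tpot_unif M s d0 h; rewrite dE sK.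
  rewrite -(fineK (tpot_fin M s y r0)) -(fineK (tpot_fin M s y' r0)) -EFinM -EFinD lee_fin.
  move=> /le_trans; apply; rewrite lerD2l.
  by rewrite mulrAC ler_pdivrMr ?ltr_wpDl// ler_pM2l// lerDl.
near=> y.
have h : `|x - y| <= d.
  near: y; have := @cvgrPdist_le _ _ _ (nbhs x) _ id x.
  by move=> [/(_ cvg_id) + _]; apply; case/andP: d0.
by rewrite ler_distlC lerBlDr !key// distrC.
Unshelve. all: by end_near. Qed.

Lemma tpot_le_pot M r s x : 0 < r -> (tpot M r s x <= pot M s x)%E.
Proof.
move=> r0; apply: ge0_le_integral => //.
- by move=> y _; rewrite lee_fin trker_ge0.
- exact: measurable_trkerE.
- exact: measurable_lk1.
- by move=> y _; exact: trker_le_lk.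
Qed.

Lemma tpot_cvg M s x : (fun n => tpot M n.+1%:R^-1 s x) @ \oo --> pot M s x.
Proof.
have -> : pot M s x = (\int[s]_y limn (fun n => (trker M n.+1%:R^-1 x y)%:E))%E.
  by apply: eq_integral => y _; apply/esym/cvg_lim => //; exact: trker_cvg.
apply: cvg_monotone_convergence => //.
- by move=> n; apply: measurable_trkerE; rewrite invr_gt0.
- by move=> n y _; rewrite lee_fin trker_ge0.
- move=> y _ m n mn; rewrite lee_fin; apply: trker_decr; first by rewrite invr_gt0.
  by rewrite lef_pV2 ?posrE// ler_nat.
Qed.

(** The potential is the supremum of its continuous truncations, hence lower semicontinuous. *)
Lemma closed_pot_le M s (c : R) : closed [set x | pot M s x <= c%:E]%E.
Proof.
rewrite (_ : [set x | _] = \bigcap_n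
  ((fun x => fine (tpot M n.+1%:R^-1 s x)) @^-1` [set y | y <= c])).
  apply: closed_bigI => n _; apply: preimage_closed; last exact: closed_le.
  by move=> y _; apply: continuous_tpot; rewrite invr_gt0.
have n0 n : (0:R) < n.+1%:R^-1 by rewrite invr_gt0.
apply/seteqP; split => x /= h.
  move=> n _ /=; rewrite -lee_fin fineK ?tpot_fin//.
  exact: le_trans (tpot_le_pot _ _ _ _) h.
rewrite -(cvg_lim _ (@tpot_cvg M s x))//.
apply: lime_le; first exact: (cvgP _ (@tpot_cvg M s x)).
by apply: nearW => n; rewrite -(fineK (tpot_fin M s x (n0 n))) lee_fin; exact: h.
Qed.

Lemma nearest_left (S : set R) x : closed S -> ~ S x -> (exists2 y, S y & y <= x) ->
  exists c, [/\ S c, c < x & forall y, S y -> y <= x -> y <= c].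
Proof.
move=> cS Sx [y0 Sy0 y0x]; pose A := S `&` [set y | y <= x].
have A0 : A !=set0 by exists y0.
have ubA : has_ubound A by exists x => y [].
have cA : closed A by apply: closedI => //; exact: closed_le.
have [Sc cx] : A (sup A) by apply: cA; exact: closure_sup.
exists (sup A); split => //.
  by rewrite lt_neqAle cx andbT; apply/eqP => e; apply: Sx; rewrite -e.
by move=> y Sy yx; apply: ub_le_sup.
Qed.

Lemma nearest_right (S : set R) x : closed S -> ~ S x -> (exists2 y, S y & x <= y) ->
  exists d, [/\ S d, x < d & forall y, S y -> x <= y -> d <= y].
Proof.
move=> cS Sx [y0 Sy0 y0x].
have [| | |c [Sc cx h]] := @nearest_left (-%R @^-1` S) (- x).
- by apply: preimage_closed => // y _; exact: opp_continuous.
- by rewrite /= opprK.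
- by exists (- y0); rewrite /= ?opprK// lerN2.
exists (- c); split => //; first by rewrite ltrNr.
move=> y Sy xy; rewrite lerNl; apply: h; first by rewrite /= opprK.
by rewrite lerN2.
Qed.

(* On each gap of [S] the kernel is convex in [x], and on an unbounded gap it is
   monotone, so the maximum is controlled by the end points of the gap. *)
Lemma maximum_principle M s (S : set R) (c : R) : closed S -> s (~` S) = 0%E ->
  0 <= c -> (forall x, S x -> pot M s x <= c%:E)%E -> forall x, (pot M s x <= c%:E)%E.
Proof.
move=> cS s0 c0 h x; have [Sx|Sx] := pselect (S x); first exact: h.
have mS : measurable S by exact: closed_measurable.
have potE z : pot M s z = (\int[s]_(y in S) lk M z y)%E.
  apply: integral_concentrated => //; first exact: measurable_lk1.
  by move=> ?; exact: lk_ge0.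
have mlk z : measurable_fun S (lk M z).
  by apply: measurable_funTS; exact: measurable_lk1.
(* For [x] to one side of all of [S], the nearest point [z] of [S] is closer than [x] to every point
   of [S], and the kernel decreases with the distance. *)
have le1 z : S z -> (forall y, S y -> `|z - y| <= `|x - y|) -> (pot M s x <= c%:E)%E.
  move=> Sz zx; apply: le_trans (h _ Sz); rewrite !potE.
  apply: ge0_le_integral => //; first by move=> ? _; exact: lk_ge0.
  by move=> y Sy; apply: lk_dist; exact: zx.
have [L|L] := pselect (exists2 y, S y & y <= x); last first.
  have [U|U] := pselect (exists2 y, S y & x <= y); last first.
    rewrite potE (_ : S = set0) ?integral_set0// -subset0 => y Sy.
    by have [xy|/ltW yx] := leP x y; [apply: U|apply: L]; exists y.
  have [d [Sd xd dS]] := nearest_right cS Sx U.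
  apply: (le1 d) => // y Sy.
  have [xy|/ltW yx] := leP x y; last by exfalso; apply: L; exists y.
  by rewrite !ler0_norm ?subr_le0// ?dS// lerN2 lerD2r ltW.
have [e [Se ex eS]] := nearest_left cS Sx L.
have [U|U] := pselect (exists2 y, S y & x <= y); last first.
  apply: (le1 e) => // y Sy.
  have [xy|/ltW yx] := leP x y; first by exfalso; apply: U; exists y.
  by rewrite !ger0_norm ?subr_ge0// ?eS// lerD2r ltW.
have [d [Sd xd dS]] := nearest_right cS Sx U.
have de : 0 < d - e by rewrite subr_gt0 (lt_trans ex).
pose u := (d - x) / (d - e).
have u01 : 0 < u < 1.
  have dx : 0 < d - x by rewrite subr_gt0.
  by rewrite /u; apply/andP; split; [exact: divr_gt0|rewrite ltr_pdivrMr// mul1r; lra].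
have xE : x = u * e + (1 - u) * d.
  by rewrite /u; field; rewrite gt_eqF.
case/andP: (u01) => u0 u1.
have v0 : 0 <= 1 - u by rewrite subr_ge0 ltW.
apply: (@le_trans _ _ (u%:E * pot M s e + (1 - u)%:E * pot M s d)%E).
  rewrite !potE -!ge0_integralZl//; try by [move=> ? _; exact: lk_ge0|rewrite lee_fin ltW].
  rewrite -ge0_integralD//; first last.
  - exact: measurable_funeM.
  - by move=> y _; rewrite mule_ge0 ?lk_ge0 ?lee_fin.
  - exact: measurable_funeM.
  - by move=> y _; rewrite mule_ge0 ?lk_ge0 ?lee_fin// ltW.
  apply: ge0_le_integral => //.
  - by move=> ? _; exact: lk_ge0.
  - by apply: emeasurable_funD; exact: measurable_funeM.
  - move=> y Sy; rewrite {1}xE; apply: lk_convex => //; first exact: lt_trans xd.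
    by have [xy|/ltW yx] := leP x y; rewrite ?(dS _ Sy xy) ?orbT// (eS _ Sy yx).
apply: (@le_trans _ _ (u%:E * c%:E + (1 - u)%:E * c%:E)%E).
  by apply: leeD; (apply: lee_wpmul2l; [rewrite lee_fin// ltW|exact: h]).
by rewrite -!EFinM -EFinD lee_fin -mulrDl addrC subrK mul1r.
Qed.

End Potential.

(** * Energy and the Frostman bound *)

Section Energy.
Variable R : realType.
Implicit Types (M r x y : R) (s t : {finite_measure set R -> \bar R}).

Lemma measurable_logker :
  measurable_fun [set: R * R] (fun z : R * R => logker z.1 z.2).
Proof.
apply: (@measurable_fun_ifT _ _ _ _ (cst +oo%E) (fun z : R * R => (- ln `|z.1 - z.2|)%:E)
  (fun z : R * R => z.1 == z.2)) => //.
- exact: measurable_fun_eqr.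
- apply/measurable_EFinP; apply: measurable_funN.
  apply: measurableT_comp; first exact: measurable_ln.
  by apply: measurableT_comp => //; exact: measurable_funB.
Qed.

(** The integral of a signed function is a difference of two nonnegative ones and that of [g] may be
    infinite, so linearity cannot be invoked. As [f >= - M] on [S], its negative part has integral
    at most [M]; integrating [f^+ + M = g + f^-] leaves only finite terms to subtract. *)
Lemma integral_shift (n : probability R R) (S : set R) (f g : R -> \bar R) M :
  0 <= M -> measurable S -> n (~` S) = 0%E ->
  measurable_fun setT f -> measurable_fun setT g -> (forall x, 0 <= g x)%E ->
  (forall x, S x -> f x = g x - M%:E)%E ->
  (\int[n]_x f x = \int[n]_x g x - M%:E)%E.
Proof.
move=> M0 mS nS mf mg g0 fg.
have mfp := measurable_funepos mf.
have mfn := measurable_funeneg mf.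
have n1 : n setT = 1%E by exact: probability_setT.
have fnM : (\int[n]_x f^\- x <= M%:E)%E.
  rewrite (integral_concentrated mS nS)//.
  apply: (@le_trans _ _ (\int[n]_(x in S) (cst M%:E) x)%E).
    apply: ge0_le_integral => //; first exact: measurable_funTS.
    move=> x Sx; rewrite funenegE (fg x Sx); move: (g0 x).
    case: (g x) => [r| |]//=; rewrite ?lee_fin => r0; last by rewrite maxNye lee_fin.
    by rewrite -EFin_max lee_fin ge_max M0 andbT; lra.
  rewrite integral_cst// -[leRHS]mule1; apply: lee_wpmul2l; first by rewrite lee_fin.
  exact: probability_le1.
have key : (\int[n]_x f^\+ x + M%:E = \int[n]_x g x + \int[n]_x f^\- x)%E.
  rewrite -ge0_integralD// -[M%:E]mule1 -n1 -integral_cst// -ge0_integralD//.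
  rewrite [LHS](integral_concentrated mS nS)//; last 2 first.
  - exact: emeasurable_funD.
  - by move=> x; rewrite adde_ge0 ?lee_fin.
  rewrite [RHS](integral_concentrated mS nS)//; last 2 first.
  - exact: emeasurable_funD.
  - by move=> x; rewrite adde_ge0.
  apply: eq_integral => x /set_mem Sx; rewrite funenegE funeposE (fg x Sx).
  move: (g0 x); case: (g x) => [r| |]//=; rewrite ?lee_fin => r0; last first.
    by rewrite maxNye adde0 addye// maxye addye.
  rewrite -!EFinD -!EFin_max -!EFinD; congr EFin.
  by case: (leP (r - M) 0) => h; case: (leP (- (r - M)) 0) => h'; lra.
have fn0 : (0 <= \int[n]_x f^\- x)%E by exact: integral_ge0.
have gg0 : (0 <= \int[n]_x g x)%E by exact: integral_ge0.
have fp0 : (0 <= \int[n]_x f^\+ x)%E by exact: integral_ge0.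
rewrite integralE; move: key fnM fn0 gg0 fp0.
case: (\int[n]_x f^\- x)%E => [b| |]//.
case: (\int[n]_x f^\+ x)%E => [a| |]//; case: (\int[n]_x g x)%E => [c| |]//=.
by move=> [h] _ _ _ _; rewrite -!EFinB; congr EFin; lra.
Qed.

(** [integral_shift] is applied twice, to the outer integral and to the inner one at each point of
    [E]. *)
Lemma log_energyE (n : probability R R) (E : set R) M :
  0 <= M -> measurable E -> n (~` E) = 0%E ->
  (forall x y, E x -> E y -> `|x - y| <= expR M) ->
  (log_energy n = \int[n]_x pot M n x - M%:E)%E.
Proof.
move=> M0 mE nE EM; rewrite /log_energy.
have mlog x : measurable_fun [set: R] (logker x).
  exact: (measurable_fun_pair2 x measurable_logker).
apply: (integral_shift M0 mE nE).
- pose F (z : R * R) := logker z.1 z.2.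
  rewrite (_ : (fun x => _) =
      (fun x => \int[n]_y F^\+ (x, y) - \int[n]_y F^\- (x, y))%E);
  last first.
    apply/funext => x; rewrite integralE.
    by congr (_ - _)%E; apply: eq_integral => y _; rewrite ?funeposE ?funenegE.
  apply: emeasurable_funB.
  + apply: (measurable_fun_fubini_tonelli_F F^\+%E) => //.
    exact: measurable_funepos measurable_logker.
  + apply: (measurable_fun_fubini_tonelli_F F^\-%E) => //.
    exact: measurable_funeneg measurable_logker.
- exact: measurable_pot.
- by move=> x; exact: pot_ge0.
- move=> x Ex; apply: (integral_shift M0 mE nE) => //.
  + exact: measurable_lk1.
  + by move=> y; exact: lk_ge0.
  + by move=> y Ey; rewrite lkE ?EM// addeAC subee// add0e.
Qed.

Lemma add_scale_measure s t (c : R) : 0 <= c ->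
  exists m : {finite_measure set R -> \bar R},
  (forall A, measurable A -> m A = s A + c%:E * t A)%E /\
  (forall f : R -> \bar R, measurable_fun setT f -> (forall x, 0 <= f x)%E ->
     (\int[m]_x f x = \int[s]_x f x + c%:E * \int[t]_x f x)%E).
Proof.
move=> c0; pose m0 := measure_add s (mscale (NngNum c0) t).
have m0E A : m0 A = (s A + c%:E * t A)%E by rewrite /m0 measure_addE.
have h : (m0 setT < +oo)%E.
  by rewrite m0E ltey_eq fin_numD fin_numM// !fin_num_measure.
exists (mfrestr measurableT h); split => [A mA|f mf f0].
  by rewrite /= /mfrestr /mrestr setIT; exact: m0E.
transitivity (\int[m0]_x f x)%E.
  by apply: eq_measure_integral => A mA _; rewrite /= /mfrestr /mrestr setIT.
by rewrite ge0_integral_measure_add// ge0_integral_mscale.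
Qed.

(** The energy is quadratic in the measure, so the bound for probabilities passes to finite measures
    by normalisation. This lets [frostman] perturb [rho] without dividing by the new mass there. *)
Lemma energy_homog M (E : set R) (I : R) s : 0 <= I ->
  (forall n : probability R R, n (~` E) = 0%E -> I%:E <= \int[n]_x pot M n x)%E ->
  s (~` E) = 0%E ->
  ((I * fine (s setT) ^+ 2)%:E <= \int[s]_x pot M s x)%E.
Proof.
move=> I0 hI sE; pose c := fine (s setT).
have sc : s setT = c%:E by rewrite fineK// fin_num_measure.
have c0 : 0 <= c by rewrite fine_ge0.
rewrite -/c; have [->|cn0] := eqVneq c 0.
  by rewrite expr0n/= mulr0; apply: integral_ge0 => x _; exact: pot_ge0.
have cp : 0 < c by rewrite lt_neqAle eq_sym cn0.
have ci : 0 <= c^-1 by rewrite invr_ge0.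
pose n : probability R R := mnormalize s (dirac (0:R)).
have nE A : n A = (s A * c^-1%:E)%E.
  transitivity ((if (c%:E == 0%E) || (c%:E == +oo%E) then dirac (0:R)%R else
      fun U => s U * (fine c%:E)^-1%:E)%E A); first by rewrite -sc.
  by rewrite eqe (negbTE cn0).
have intn (f : R -> \bar R) : measurable_fun setT f -> (forall x, 0 <= f x)%E ->
    (\int[n]_x f x = c^-1%:E * \int[s]_x f x)%E.
  move=> mf f0; transitivity (\int[mscale (NngNum ci) s]_x f x)%E.
    by apply: eq_measure_integral => A mA _; rewrite [LHS]nE muleC.
  by rewrite ge0_integral_mscale.
have := hI n; rewrite nE sE mul0e => /(_ erefl).
have -> : (\int[n]_x pot M n x = c^-1%:E * (c^-1%:E * \int[s]_x pot M s x))%E.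
  rewrite -(ge0_integralZl _ _ (measurable_pot M s))//; last by move=> x _; exact: pot_ge0.
  rewrite -intn; last 2 first.
  - exact: measurable_funeM (measurable_pot M s).
  - by move=> x; rewrite mule_ge0 ?pot_ge0// lee_fin.
  apply: eq_integral => x _; rewrite /pot intn//; first exact: measurable_lk1.
  by move=> y; exact: lk_ge0.
have : (0 <= \int[s]_x pot M s x)%E by apply: integral_ge0 => x _; exact: pot_ge0.
case: (\int[s]_x pot M s x)%E => [a| |]//=; last by move=> _ _; rewrite leey.
rewrite -!EFinM !lee_fin => a0 h.
by rewrite -ler_pdivlMr ?exprn_gt0// expr2 invfM mulrC -mulrA.
Qed.

Lemma ler_affine_gt0 (a b c : R) : (forall u, 0 < u -> a <= b + u * c) -> a <= b.
Proof.
move=> h; rewrite leNgt; apply/negP => ba.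
have c0 : 0 < `|c| + 1 by rewrite ltr_wpDl.
pose u := (a - b) / (2 * (`|c| + 1)).
have u0 : 0 < u by rewrite divr_gt0 ?subr_gt0 ?mulr_gt0.
have := h _ u0.
have : u * c <= (a - b) / 2.
  apply: (@le_trans _ _ (u * (`|c| + 1))).
    by rewrite ler_pM2l// (le_trans (ler_norm _))// lerDl.
  rewrite /u le_eqVlt; apply/orP; left; apply/eqP; field; lra.
by lra.
Qed.

(* Comparing [rho] with the normalisation of [rho + u rho|_A], [A = {pot <= I + d}],
   and letting [u -> 0] shows that [rho] does not charge the complement of [A]. *)
Lemma frostman M (E : set R) (I : R) (rho : probability R R) : 0 <= I ->
  (forall n : probability R R, n (~` E) = 0%E -> I%:E <= \int[n]_x pot M n x)%E ->
  measurable E -> rho (~` E) = 0%E -> (\int[rho]_x pot M rho x = I%:E)%E ->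
  forall x, (pot M rho x <= I%:E)%E.
Proof.
move=> I0 hI mE rhoE rhoI x; apply/lee_addgt0Pr => d d0; rewrite -EFinD.
pose A := [set x | pot M rho x <= (I + d)%:E]%E.
have cA : closed A by exact: closed_pot_le.
have mA : measurable A by exact: closed_measurable.
apply: (@maximum_principle _ _ _ A) => //; last by rewrite addr_ge0// ltW.
have [t tE] := restrict_measure rho mA.
have potm := measurable_pot M.
have intt f (mf : measurable_fun setT f) (f0 : forall x, (0 <= f x)%E) :=
  integral_restrict mA tE mf f0.
have tle f : measurable_fun setT f -> (forall x, 0 <= f x)%E ->
    (\int[t]_x f x <= \int[rho]_x f x)%E.
  by move=> mf f0; rewrite intt//; apply: ge0_subset_integral.
pose J := fine (\int[t]_x pot M rho x)%E.
have JI : (\int[t]_x pot M rho x <= I%:E)%E.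
  by rewrite -rhoI; apply: tle => // y; exact: pot_ge0.
have J0 : (0 <= \int[t]_x pot M rho x)%E by apply: integral_ge0 => y _; exact: pot_ge0.
have JE : (\int[t]_x pot M rho x = J%:E)%E.
  by rewrite fineK// ge0_fin_numE// (le_lt_trans JI)// ltry.
pose L := fine (\int[t]_x pot M t x)%E.
have LE : (\int[t]_x pot M t x = L%:E)%E.
  rewrite fineK// ge0_fin_numE; last by apply: integral_ge0 => y _; exact: pot_ge0.
  apply: (@le_lt_trans _ _ (\int[t]_x pot M rho x)%E); last by rewrite JE ltry.
  apply: ge0_le_integral => //; first by move=> y _; exact: pot_ge0.
  move=> y _; apply: tle; first exact: measurable_lk1.
  by move=> z; exact: lk_ge0.
pose a := fine (rho A).
have aE : rho A = a%:E by rewrite fineK// fin_num_measure.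
(* The perturbed measure has mass [1 + u a] and energy [I + 2 u J + u^2 L]. Comparing with
   [I (1 + u a)^2] and dividing by [u] gives [2 a I <= 2 J + u (L - a^2 I)], the input of
   [ler_affine_gt0]. *)
have aJ : a * I <= J.
  suff : 2 * (a * I) <= 2 * J by rewrite ler_pM2l.
  apply: (@ler_affine_gt0 _ _ (L - a ^+ 2 * I)) => u u0.
  have [m [mAE mint]] := add_scale_measure rho t (ltW u0).
  have m1 : m setT = (1 + u * a)%:E.
    rewrite mAE//; have -> : t setT = a%:E by rewrite tE setTI.
    by have := probability_setT rho => /= ->; rewrite -EFinM -EFinD.
  have mE0 : m (~` E) = 0%E.
    rewrite mAE ?rhoE; last exact: measurableC.
    have -> : t (~` E) = 0%E; last by rewrite mule0 adde0.
    have := tE (~` E); rewrite (subset_measure0 _ _ _ rhoE)//.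
    - exact: measurableI (measurableC mE) mA.
    - exact: measurableC.
  have := @energy_homog M E I m I0 hI mE0; rewrite m1 /=.
  have -> : (\int[m]_x pot M m x = (I + u * J + u * (J + u * L))%:E)%E.
    have pm : pot M m = (fun y => pot M rho y + u%:E * pot M t y)%E.
      apply/funext => y; rewrite /pot mint//; first exact: measurable_lk1.
      by move=> z; exact: lk_ge0.
    have intpm (s : {finite_measure set R -> \bar R}) :
        (\int[s]_x pot M m x = \int[s]_x pot M rho x + u%:E * \int[s]_x pot M t x)%E.
      rewrite pm ge0_integralD//; last 3 first.
      - by move=> y _; exact: pot_ge0.
      - by move=> y _; rewrite mule_ge0 ?pot_ge0// lee_fin ltW.
      - exact: measurable_funeM.
      rewrite ge0_integralZl//; last by rewrite lee_fin ltW.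
      by move=> y _; exact: pot_ge0.
    rewrite mint//; last by move=> y; exact: pot_ge0.
    rewrite !intpm rhoI JE LE (pot_sym M rho t) JE.
    by rewrite -!(EFinM, EFinD).
  rewrite lee_fin => h.
  rewrite -(ler_pM2l u0); move: h; rewrite !expr2; nra.
have BE : (\int[rho]_(x in ~` A) pot M rho x = (I - J)%:E)%E.
  have := rhoI; rewrite -(setUv A) ge0_integral_setU//; last 4 first.
  - exact: measurableC.
  - by rewrite setUv.
  - by move=> y _; exact: pot_ge0.
  - exact/disj_setPCl.
  rewrite -intt//; last by move=> y; exact: pot_ge0.
  rewrite JE; have : (0 <= \int[rho]_(x in ~` A) pot M rho x)%E.
    by apply: integral_ge0 => y _; exact: pot_ge0.
  by case: (\int[rho]_(x in ~` A) pot M rho x)%E => // b _ [] <-; rewrite addrAC subrr add0r.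
have bE : rho (~` A) = (1 - a)%:E.
  by rewrite probability_setC// aE.
(* Off [A] the potential exceeds [I + d], so [(I + d)(1 - a) <= I - J <= I (1 - a)], which forces
   the mass [1 - a] of the complement to vanish. *)
have : ((I + d)%:E * rho (~` A) <= (I - J)%:E)%E.
  rewrite -BE -integral_cst; last exact: measurableC.
  apply: ge0_le_integral => //.
  - exact: measurableC.
  - by move=> y _; rewrite lee_fin addr_ge0// ltW.
  - exact: measurable_funTS.
  - by move=> y /= /negP; rewrite -ltNge => /ltW.
rewrite bE -EFinM lee_fin => h.
have a1 : a <= 1 by rewrite -lee_fin -aE probability_le1.
have : d * (1 - a) <= 0 by lra.
rewrite pmulr_rle0// => a1'; apply: etrans bE _; congr EFin.
by apply/eqP; rewrite eq_le a1' subr_ge0.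
Qed.

End Energy.

(** * Limits of empirical measures *)

Section WeakLimit.
Variable R : realType.

(** Compactness of the segment gives a cluster point, and an ultrafilter converges to each of its
    cluster points. *)
Lemma ultra_cvg (T : pointedType) (U : set_system T) (f : T -> R) (a b : R) :
  UltraFilter U -> (forall i, a <= f i <= b) -> exists l : R, f @ U --> l.
Proof.
move=> UU fab; have [l [_ cl]] : `[a, b] `&` cluster (f @ U) !=set0.
  apply: segment_compact; apply: (@filterS _ U _ setT); last exact: filterT.
  by move=> i _ /=; rewrite in_itv /= fab.
exists l => V /= Vl; have [//|UV] := in_ultra_setVsetC (f @^-1` V) UU.
by have [y [/= nVy Vy]] := cl (~` V) V UV Vl.
Qed.

Lemma lim_filter_le (T : Type) (F : set_system T) (FF : ProperFilter F)
    (f : T -> R) (l c : R) :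
  F [set t | f t <= c] -> f @ F --> l -> l <= c.
Proof.
move=> fc fl; rewrite leNgt; apply/negP => cl.
have [t [/= h1 h2]] := filter_ex (filterI fc (cvgr_gt _ fl _ cl)).
by move: h2; rewrite ltNge h1.
Qed.

Lemma cvg_sum_ord (T : Type) (F : set_system T) (FF : Filter F) N
    (f : nat -> T -> R) (l : nat -> R) :
  (forall k, f k @ F --> l k) ->
  (fun t => \sum_(k < N) f k t) @ F --> \sum_(k < N) l k.
Proof.
move=> h; elim: N => [|N IH].
  rewrite big_ord0 (_ : (fun t => _) = cst 0); first exact: cvg_cst.
  by apply/funext => t; rewrite big_ord0.
rewrite big_ord_recr (_ : (fun t => _) = (fun t => \sum_(k < N) f k t + f N t)).
  exact: cvgD.
by apply/funext => t; rewrite big_ord_recr.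
Qed.

Lemma pushforward_probability d (T : measurableType d) (l : {measure set T -> \bar R})
    (q : T -> R) : measurable_fun setT q -> l setT = 1%E ->
  exists s : probability R R,
    (forall A, s A = l (q @^-1` A)) /\
    (forall f : R -> \bar R, measurable_fun setT f -> (forall y, 0 <= f y)%E ->
      (\int[s]_y f y = \int[l]_u f (q u))%E).
Proof.
(* The mass is already one: normalising only supplies the probability structure, and the default
   [dirac 0] is never reached. *)
move=> mq l1; pose s' := mnormalize (pushforward l q) (dirac (0:R)%R).
pose s : probability R R := s' mq.
have sE A : s A = l (q @^-1` A).
  rewrite /s /s' /= /mnormalize /= /pushforward preimage_setT.
  transitivity ((if (1%E == 0 :> \bar R) || (1%E == +oo :> \bar R) then dirac (0:R)%R else
     fun U => l (q @^-1` U) * (fine 1)^-1%:E)%E A); first by rewrite -l1.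
  by rewrite onee_eq0 /= invr1 mule1.
exists s; split => [//|f mf f0].
transitivity (\int[pushforward l q]_y f y)%E.
  by apply: eq_measure_integral => A mA _; exact: sE.
by rewrite (ge0_integral_pushforward mq)// preimage_setT.
Qed.

(** [lebesgue_measure] is taken on the copy [measurableTypeR R] of the line; the push-forward by the
    identity carries it to [R]. *)
Lemma unit_interval_measure : exists l : probability R R,
  forall A, l A = lebesgue_measure (A `&` `[0, 1[).
Proof.
pose I01 : set (measurableTypeR R) := `[0, 1[%classic.
have mI : measurable I01 by exact: measurable_itv.
have l1 : lebesgue_measure I01 = 1%E.
  by rewrite lebesgue_measure_itv /= lte_fin ltr01 oppr0 adde0.
have mid : @measurable_fun _ _ (measurableTypeR R) R setT idfun.
  by move=> _ A mA; rewrite setTI.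
have [|l [lE _]] := @pushforward_probability _ (measurableTypeR R)
  (mrestr (@lebesgue_measure R) mI) idfun mid.
  by rewrite /= /mrestr setTI.
by exists l => A; rewrite lE.
Qed.

Variables (x : nat -> R) (E : set R).
Hypotheses (cE : compact E) (xE : forall n, E (x n)).

Let ind (b : bool) : R := b%:R.
Let freq n t : R := (\sum_(i < n) ind (x i < t)) / n%:R.

Let freq_ge0 n t : 0 <= freq n t.
Proof. by rewrite /freq divr_ge0// sumr_ge0// => i _; rewrite ler0n. Qed.

Let freq_le1 n t : freq n t <= 1.
Proof.
rewrite /freq; have [->|n0] := posnP n; first by rewrite invr0 mulr0.
rewrite ler_pdivrMr ?ltr0n// mul1r -[leRHS]mulr1 -[n in leRHS]card_ord mulr_natl.
by rewrite -sumr_const ler_sum// => i _; rewrite /ind; case: (_ < _).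
Qed.

Let freq_mono n t t' : t <= t' -> freq n t <= freq n t'.
Proof.
move=> tt; rewrite /freq ler_wpM2r ?invr_ge0// ler_sum// => i _.
rewrite /ind ler_nat; case: (ltP (x i) t) => // h.
by rewrite (lt_le_trans h).
Qed.

(* [s] is the image of the Lebesgue measure on [0, 1[ under the quantile function
   of the limit of the empirical measures along an ultrafilter. *)
Lemma empirical_limit : exists (U : set_system nat) (s : probability R R),
  [/\ UltraFilter U, \oo `<=` U, s (~` E) = 0%E &
   forall f : R -> R, (forall y, 0 <= f y) -> measurable_fun setT f ->
     (forall e, 0 < e -> exists2 d, 0 < d & forall y z, `|y - z| <= d -> f y <= f z + e) ->
     forall e, 0 < e -> U [set n |
       (\int[s]_y (f y)%:E <= ((\sum_(i < n) f (x i)) / n%:R + e)%:E)%E]].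
Proof.
have [U [UU ooU]] : exists U, UltraFilter U /\ \oo `<=` U.
  exact: ultraFilterLemma.
have UP : ProperFilter U by exact: ultra_proper.
have FU : Filter U by exact: filter_filter.
have [H HU] : exists H : R -> R, forall t, (fun n => freq n t) @ U --> H t.
  have h t : exists l : R, (fun n => freq n t) @ U --> l.
    by apply: (@ultra_cvg _ _ _ 0 1) => // n; rewrite freq_ge0 freq_le1.
  by have [H HP] := choice h; exists H.
have Hcmp t (l : R) : (\forall n \near U, freq n t <= l) -> H t <= l.
  by move=> h; exact: (@lim_filter_le _ U UP (fun n => freq n t) (H t) l h (HU t)).
have H0 t : 0 <= H t.
  rewrite -oppr_le0; apply: (@lim_filter_le _ U UP (fun n => - freq n t) _ _ _ (cvgN (HU t))).
  by apply: nearW => n /=; rewrite oppr_le0 freq_ge0.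
have H1 t : H t <= 1 by apply: Hcmp; apply: nearW => n; exact: freq_le1.
have Hmono t t' : t <= t' -> H t <= H t'.
  move=> tt; rewrite -subr_le0.
  apply: (@lim_filter_le _ U UP (fun n => freq n t - freq n t') _ _ _ (cvgB (HU t) (HU t'))).
  by apply: nearW => n /=; rewrite subr_le0 freq_mono.
(* No term of the sequence falls in a gap of [E], so [H] is constant across gaps; this will keep the
   quantiles in [E]. *)
have Heq t t' : (forall y, E y -> (y < t) = (y < t')) -> H t = H t'.
  move=> h; have ee : (fun n => freq n t) = (fun n => freq n t').
    apply/funext => n; rewrite /freq; congr (_ / _).
    by apply: eq_bigr => i _; rewrite (h _ (xE i)).
  have := HU t'; rewrite -ee => h'.
  exact: (cvg_unique (@Rhausdorff R) (HU t) h').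
have [B [_ /(_ (B + 1))]] := compact_bounded cE; rewrite ltrDl => /(_ ltr01) EB.
pose b := B + 2.
have Eb y : E y -> - b < y < b.
  by move=> /EB /=; rewrite ler_norml => /andP[h1 h2]; apply/andP; rewrite /b; split; lra.
have b0 : 0 < b by have /andP[] := Eb _ (xE 0); lra.
have HL t : t <= - b -> H t = 0.
  move=> tb; apply/eqP; rewrite eq_le H0 andbT; apply: Hcmp; apply: nearW => n.
  rewrite /freq big1 ?mul0r// => i _; rewrite /ind.
  by have /andP[h _] := Eb _ (xE i); rewrite ltNge (le_trans tb (ltW h)).
have HR t : b <= t -> H t = 1.
  move=> bt; apply/eqP; rewrite eq_le H1 /=.
  rewrite -lerN2; apply: (@lim_filter_le _ U UP (fun n => - freq n t) _ _ _ (cvgN (HU t))).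
  apply: ooU; exists 1%N => // n /= n0.
  rewrite lerN2 /freq (eq_bigr (fun=> 1)); last first.
    by move=> i _; rewrite /ind; have /andP[_ h] := Eb _ (xE i); rewrite (lt_le_trans h bt).
  by rewrite sumr_const card_ord divff// pnatr_eq0 -lt0n.
(* The clause [t = - b] keeps [S u] nonempty for every real [u], negative ones included, so that [q]
   is nondecreasing on the whole line and hence measurable. *)
pose S u := [set t | - b <= t <= b /\ (H t <= u \/ t = - b)].
have Sb u : S u (- b) by split; [rewrite lexx /= ; lra|right].
have Sub u : has_ubound (S u) by exists b => t [/andP[]].
have Ssup u : has_sup (S u) by split; [exists (- b)|].
pose q u := sup (S u).
have q_nd : nondecreasing_fun q.
  move=> u v uv; apply: ge_sup; first by exists (- b).
  move=> t [tb tu]; apply: ub_le_sup => //; split => //.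
  by case: tu => [h|]; [left; exact: le_trans uv|right].
have mq : measurable_fun [set: R] q by exact: nondecreasing_measurable.
have qge u t : - b <= t <= b -> H t <= u -> t <= q u.
  by move=> tb Ht; apply: ub_le_sup => //; split => //; left.
have qle u t : 0 <= u -> u < H t -> q u <= t.
  move=> u0 ut; apply: ge_sup; first by exists (- b).
  move=> t' [/andP[t'b _] [Ht'|->]].
    by rewrite leNgt; apply/negP => /ltW/Hmono; rewrite leNgt (le_lt_trans Ht').
  by rewrite leNgt; apply/negP => /ltW tb; move: ut; rewrite HL// ltNge u0.
(* Were [q u] outside the closed set [E], a neighbourhood would miss [E] and [H] would be constant
   on it; a point slightly to the right of [q u] would then still belong to [S u]. *)
have qE u : 0 <= u < 1 -> E (q u).
  move=> /andP[u0 u1]; apply: contrapT => nE.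
  have [e e0 eE] : exists2 e : R, 0 < e & forall y, E y -> ~~ (`|q u - y| < e).
    have : closed E by apply: compact_closed => //; exact: Rhausdorff.
    rewrite -openC openE => /(_ _ nE) /nbhs_ballP[e /= e0 h]; exists e => // y Ey.
    by apply/negP => ye; exact: (h y ye).
  have [t [tb tu] te] := sup_adherent e0 (Ssup u).
  have tq : t <= q u by apply: ub_le_sup.
  have Htu : H t <= u by case: tu => [//|->]; rewrite HL.
  have qb : q u + e / 2 <= b.
    have hb : q u <= b by apply: ge_sup; [exists (- b)|move=> ? [/andP[]]].
    rewrite leNgt; apply/negP => h; suff : H t = 1 by move=> Ht1; move: u1; rewrite ltNge -Ht1 Htu.
    rewrite -(HR b)//; apply: Heq => y Ey; have := eE y Ey.
    have /andP[_ yb] := Eb _ Ey; rewrite yb.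
    rewrite -leNgt ler_normr => hy; apply/idP.
    by move: te tq hy; rewrite -/(q u) => te tq /orP[] ?; lra.
  have : q u + e / 2 <= q u.
    apply: qge; first by rewrite qb andbT; case/andP: tb => *; lra.
    rewrite (_ : H _ = H t)//; apply: Heq => y Ey; have := eE y Ey.
    rewrite -leNgt ler_normr => hy; apply/idP/idP => hh;
    by move: te tq hy hh; rewrite -/(q u) => te tq /orP[] ? ?; lra.
  by lra.
have [l lE] := unit_interval_measure.
have [s [sE sint]] := pushforward_probability mq (probability_setT l).
pose I01 : set R := `[0, 1[%classic.
have mI : measurable I01 by exact: measurable_itv.
have slE A : s A = lebesgue_measure (q @^-1` A `&` I01) by rewrite sE; exact: lE.
have lI : l (~` I01) = 0%E by rewrite lE setICl measure0.
exists U, s; split => //.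
  rewrite slE (_ : _ `&` _ = set0) ?measure0//.
  rewrite -subset0 => u [/= nE]; rewrite /I01 /= in_itv /= => u01.
  by apply: nE; exact: qE.
move=> f f0 mf funif e e0.
have e3 : 0 < e / 4 by lra.
have [d d0 fd] := funif _ e3.
pose N := (Num.truncn (2 * b / d)).+1.
pose t k := - b + k%:R * d.
have tN : b < t N.
  have : 2 * b / d < N%:R by exact: truncnS_gt.
  by rewrite ltr_pdivrMr// /t; lra.
have tS k : t k.+1 = t k + d by rewrite /t -natr1; ring.
have tmono k : t k <= t k.+1 by rewrite tS; lra.
have t0 : t 0 = - b by rewrite /t mul0r addr0.
have ints : (\int[s]_y (f y)%:E = \int[l]_(u in I01) (f (q u))%:E)%E.
  rewrite sint; [|exact/measurable_EFinP|by move=> y; rewrite lee_fin].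
  apply: integral_concentrated => //.
  - by apply/measurable_EFinP; exact: measurableT_comp.
  - by move=> y; rewrite lee_fin.
have f1 (k : nat) : 0 <= f (t k) + e / 4 by rewrite addr_ge0// ltW.
(* Upper Stieltjes sum on a grid of step [d]: for [u] in [[H (t k), H (t k.+1)[] the quantile [q u]
   lies in [[t k, t k.+1]], where [f] is at most [f (t k) + e / 4]. *)
have up : (\int[s]_y (f y)%:E <=
    (\sum_(k < N) (f (t k) + e / 4) * (H (t k.+1) - H (t k)))%:E)%E.
  pose J k : set R := `[H (t k), H (t k.+1)[%classic.
  have mJ k : measurable (J k) by exact: measurable_itv.
  have m1 k : measurable_fun I01 (fun u => (\1_(J k) u : R)%:E).
    exact/measurable_EFinP/measurable_indic.
  apply: (@le_trans _ _ (\int[l]_(u in I01)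
     \sum_(k < N) ((f (t k) + e / 4)%:E * (\1_(J k) u)%:E))%E).
    rewrite ints; apply: ge0_le_integral => //.
    - by move=> y _; rewrite lee_fin.
    - by apply/measurable_funTS/measurable_EFinP; exact: measurableT_comp.
    - apply: emeasurable_sum => k; apply: measurable_funeM.
      exact: m1.
    move=> u; rewrite /I01 /= in_itv /= => /andP[u0 u1].
    have uJ k : (\1_(J k) u : R) = ind (u < H (t k.+1)) - ind (u < H (t k)).
      rewrite indicE /J mem_setE in_itv /= /ind; have := Hmono _ _ (tmono k).
      by case: (leP (H (t k)) u) => ?; case: (ltP u (H (t k.+1))) => ? ?; rewrite ?subrr ?subr0 //=; lra.
    rewrite sumEFin lee_fin.
    have -> : f (q u) = \sum_(k < N) f (q u) * \1_(J k) u.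
      rewrite -mulr_sumr (eq_bigr (fun k : 'I_N => ind (u < H (t k.+1)) - ind (u < H (t k))));
        last by move=> k _; exact: uJ.
      rewrite -(big_mkord xpredT (fun k => ind (u < H (t k.+1)) - ind (u < H (t k)))).
      rewrite (telescope_sumr (fun k => ind (u < H (t k))))//.
      by rewrite HR ?(ltW tN)// t0 HL// u1 ltNge u0 /ind subr0 mulr1.
    apply: ler_sum => k _; rewrite indicE /J mem_setE in_itv /=.
    case: (boolP (_ && _)); rewrite ?mulr0// !mulr1 => /andP[h1 h2].
    have tk : t k <= q u.
      apply: qge => //; rewrite /t; apply/andP; split.
        by rewrite lerDl mulr_ge0// ltW.
      rewrite leNgt; apply/negP => /ltW/HR h; move: h1 u1; rewrite h; lra.
    have qt : q u <= t k.+1 by apply: qle.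
    by apply: fd; rewrite ger0_norm ?subr_ge0//; rewrite tS in qt; lra.
  rewrite ge0_integral_sum//; last 2 first.
  - by move=> k; apply: measurable_funeM; exact: m1.
  - by move=> k y _; rewrite mule_ge0// lee_fin.
  rewrite -sumEFin; apply: lee_sum => k _.
  rewrite ge0_integralZl ?lee_fin//.
  rewrite integral_indic// EFinM; apply: lee_wpmul2l; first by rewrite lee_fin.
  apply: (@le_trans _ _ (lebesgue_measure (J k))).
    apply: (le_trans (y := lebesgue_measure (J k `&` I01 `&` I01))); first by rewrite -lE.
    apply: le_measure; rewrite ?inE; last by move=> ? [[]].
      exact: (measurableI _ _ (measurableI _ _ (mJ k) mI) mI).
    exact: mJ.
  rewrite /J lebesgue_measure_itv /=; case: ifP => //= _.
  by rewrite lee_fin subr_ge0 Hmono.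
(* The same sum for the empirical distribution. The error [e] is spent as [e / 2] on the convergence
   of these finite sums along [U] and as twice [e / 4] on the oscillation of [f] in a grid cell,
   from [q u] to [t k] and from [t k] to [x i]. *)
pose G n := \sum_(k < N) (f (t k) + e / 4) * (freq n (t k.+1) - freq n (t k)).
have GU : G @ U --> \sum_(k < N) (f (t k) + e / 4) * (H (t k.+1) - H (t k)).
  apply: (@cvg_sum_ord _ U FU N
    (fun k n => (f (t k) + e / 4) * (freq n (t k.+1) - freq n (t k)))
    (fun k => (f (t k) + e / 4) * (H (t k.+1) - H (t k)))) => k; apply: cvgM; first exact: cvg_cst.
  by apply: cvgB; exact: HU.
have Gle n : (0 < n)%N -> G n <= (\sum_(i < n) f (x i)) / n%:R + e / 2.
  move=> n0; have n0' : (0:R) < n%:R by rewrite ltr0n.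
  have -> : G n = (\sum_(i < n) \sum_(k < N) (f (t k) + e / 4) *
      (ind (x i < t k.+1) - ind (x i < t k))) / n%:R.
    rewrite exchange_big /= mulr_suml; apply: eq_bigr => k _.
    rewrite -mulr_sumr sumrB -mulrA; congr (_ * _).
    by rewrite /freq mulrBl.
  rewrite -(ler_pM2r n0') mulrDl !divfK ?gt_eqF//.
  have -> : e / 2 * n%:R = \sum_(i < n) e / 2.
    by rewrite sumr_const card_ord mulr_natr.
  rewrite -big_split /=; apply: ler_sum => i _.
  apply: (@le_trans _ _ (\sum_(k < N) (f (x i) + e / 2) *
      (ind (x i < t k.+1) - ind (x i < t k)))).
    apply: ler_sum => k _; rewrite /ind; have := tmono k.
    case: (ltP (x i) (t k)) => h; case: (ltP (x i) (t k.+1)) => h' tk;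
      rewrite ?subrr ?mulr0//; first by lra.
    rewrite subr0 !mulr1; have : f (t k) <= f (x i) + e / 4.
      by apply: fd; rewrite ler0_norm ?subr_le0//; rewrite tS in h'; lra.
    by lra.
  rewrite -mulr_sumr -(big_mkord xpredT (fun k => ind (x i < t k.+1) - ind (x i < t k))).
  rewrite (telescope_sumr (fun k => ind (x i < t k)))//.
  have /andP[h1 h2] := Eb _ (xE i).
  by rewrite (lt_trans h2 tN) t0 ltNge (ltW h1) /ind subr0 mulr1.
have e2 : 0 < e / 2 by lra.
have h1 : U [set n | (0 < n)%N] by apply: ooU; exists 1%N.
apply: (@filterS2 _ U FU _ _ _ _ h1 (cvgr_dist_le _ _ GU _ e2)) => n /= n0.
rewrite ler_norml => /andP[_ h]; apply: (le_trans up).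
rewrite lee_fin; have := Gle n n0; lra.
Qed.

End WeakLimit.

(** * Polynomials with small sup norm *)

Section Chebyshev.
Variable R : realType.

Lemma filter_forall_lt (T : Type) (F : set_system T) (FF : Filter F) (N : nat)
    (P : nat -> T -> Prop) :
  (forall k, F (P k)) -> F [set t | forall k, (k < N)%N -> P k t].
Proof.
move=> h; elim: N => [|N IH]; first by apply: filterS filterT.
apply: filterS2 IH (h N) => t /= h1 h2 k; rewrite ltnS leq_eqVlt.
by move=> /orP[/eqP ->//|]; exact: h1.
Qed.

Lemma trker_unif_eps (M r e : R) : 0 < r -> 0 < e ->
  exists2 d, 0 < d & forall x y x' y' : R, `| `|x - y| - `|x' - y'| | <= d ->
    trker M r x y <= trker M r x' y' + e.
Proof.
move=> r0 e0; pose d := r * (1 - expR (- e)).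
have d0 : 0 < d < r.
  rewrite /d mulr_gt0 ?subr_gt0 ?expR_lt1 ?oppr_lt0//=.
  by rewrite gtr_pMr// gtrBl expR_gt0.
have dE : - ln (1 - d / r) = e.
  by rewrite /d mulrAC divff ?gt_eqF// mul1r opprB addrC subrK expRK opprK.
exists d => [|x y x' y' h]; first by case/andP: d0.
by have := trker_unif M d0 h; rewrite dE.
Qed.

Lemma measurable_tpot (M r : R) (s : {finite_measure set R -> \bar R}) : 0 < r ->
  measurable_fun [set: R] (tpot M r s).
Proof.
move=> r0.
apply: (measurable_fun_fubini_tonelli_F (fun z : R * R => (trker M r z.1 z.2)%:E)).
  by apply/measurable_EFinP; exact: measurable_trker.
by move=> z; rewrite lee_fin trker_ge0.
Qed.

(** Each point depends on all earlier ones, so the recursion carries their list [L n], newest first,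
    and the choice function is applied to the whole list. *)
Lemma leja_seq (E : set R) (c : R) :
  (forall s : seq R, exists x, E x /\ c ^+ size s <= \prod_(y <- s) `|x - y|) ->
  exists x : nat -> R, forall n, E (x n) /\ c ^+ n <= \prod_(i < n) `|x n - x i|.
Proof.
move=> /choice[ch chP].
pose L := fix L n := if n is n'.+1 then ch (L n') :: L n' else [::].
have Ls n : size (L n) = n by elim: n => //= n ->.
have Lp (g : R -> R) n : \prod_(y <- L n) g y = \prod_(i < n) g (ch (L i)).
  elim: n => [|n IH]; first by rewrite big_nil big_ord0.
  by rewrite /= big_cons IH big_ord_recr mulrC.
exists (fun n => ch (L n)) => n; have [h1 h2] := chP (L n); split => //.
by move: h2; rewrite Ls Lp.
Qed.

Lemma ln_prod n (F : 'I_n -> R) : (forall i, 0 < F i) ->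
  \sum_(i < n) ln (F i) = ln (\prod_(i < n) F i).
Proof.
move=> F0; suff [] : \sum_(i < n) ln (F i) = ln (\prod_(i < n) F i) /\
  0 < \prod_(i < n) F i by [].
elim/big_rec2 : _ => [|i u v _ [-> v0]]; first by rewrite ln1.
by rewrite lnM ?posrE// mulr_gt0.
Qed.

(** Passing from [n] to [n.+1] points adds a row and a column, each at most [n (M - ln c)] by the
    choice of [x n], and one diagonal term, finite thanks to the truncation. The diagonal has total
    order [n] and disappears after division by [n^2]. *)
Lemma leja_sum (x : nat -> R) (c M r : R) (E : set R) : 0 < c -> 0 < r ->
  (forall n, E (x n)) -> (forall y z, E y -> E z -> `|y - z| <= expR M) ->
  (forall n, c ^+ n <= \prod_(i < n) `|x n - x i|) -> forall n,
  \sum_(i < n) \sum_(j < n) trker M r (x i) (x j) <=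
    n%:R ^+ 2 * (M - ln c) + n%:R * Num.max 0 (M - ln r).
Proof.
move=> c0 r0 xE EM xc.
have xne n (i : 'I_n) : 0 < `|x n - x i|.
  have : 0 < \prod_(i < n) `|x n - x i| by apply: lt_le_trans (xc n); rewrite exprn_gt0.
  rewrite (bigD1 i)//= => h; rewrite lt_neqAle normr_ge0 andbT eq_sym.
  by apply: contraTneq h => ->; rewrite mul0r ltxx.
have row n : \sum_(i < n) trker M r (x n) (x i) <= n%:R * (M - ln c).
  apply: (@le_trans _ _ (\sum_(i < n) (M - ln `|x n - x i|))).
    apply: ler_sum => i _; have h := xne n i.
    apply: (@le_trans _ _ (Num.max 0 (M - ln `|x n - x i|))).
      by apply: trker_le_ln => //; rewrite le_max lexx orbT.
    by rewrite max_r// subr_ge0 -ler_expR lnK ?posrE// EM.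
  rewrite sumrB sumr_const card_ord mulrBr [n%:R * M]mulr_natl lerD2l lerN2.
  have -> : \sum_(i < n) ln `|x n - x i| = ln (\prod_(i < n) `|x n - x i|).
    by apply: ln_prod => i; exact: xne.
  rewrite mulr_natl -lnXn// ler_ln ?posrE ?exprn_gt0//.
  by apply: lt_le_trans (xc n); rewrite exprn_gt0.
have A0 : 0 <= M - ln c.
  have := xc 1; rewrite big_ord_recl big_ord0 mulr1 expr1 => h.
  rewrite subr_ge0 -ler_expR lnK ?posrE// (le_trans h)// EM//.
elim=> [|n IH]; first by rewrite big_ord0 expr0n /= !mul0r addr0.
have -> : \sum_(i < n.+1) \sum_(j < n.+1) trker M r (x i) (x j) =
   \sum_(i < n) \sum_(j < n) trker M r (x i) (x j) +
   (\sum_(i < n) trker M r (x n) (x i)) *+ 2 + trker M r (x n) (x n).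
  rewrite big_ord_recr /= big_ord_recr /=.
  under eq_bigr => i _ do rewrite big_ord_recr /=.
  rewrite big_split /= mulr2n -!addrA; congr (_ + (_ + _)).
  by apply: eq_bigr => i _; rewrite trkerC.
have := row n; have := @trker_le R M r (x n) (x n) r0.
move: IH; set a := \sum_(i < n) _; set b := \sum_(i < n) _; set d := trker _ _ _ _.
set B := Num.max _ _; set A := M - ln c in A0 *.
rewrite -natr1 mulr2n; nra.
Qed.

(** [empirical_limit] handles one function at a time, whereas the energy is a double integral.
    Equicontinuity of the truncated kernel reduces one variable to a finite net covering [E], and
    finitely many conditions along [U] hold at a common index [n]. *)
Lemma leja_measure (E : set R) (x : nat -> R) (c M : R) : compact E -> 0 < c ->
  (forall n, E (x n)) -> (forall y z, E y -> E z -> `|y - z| <= expR M) ->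
  (forall n, c ^+ n <= \prod_(i < n) `|x n - x i|) ->
  exists s : probability R R, s (~` E) = 0%E /\
    (\int[s]_y pot M s y <= (M - ln c)%:E)%E.
Proof.
move=> cE c0 xE EM xc.
have [U [s [UU ooU sE sint]]] := empirical_limit cE xE.
have UP : ProperFilter U by exact: ultra_proper.
have FU : Filter U by exact: filter_filter.
exists s; split => //.
have s1 : s setT = 1%E by exact: probability_setT.
suff key r : 0 < r -> (\int[s]_y tpot M r s y <= (M - ln c)%:E)%E.
  have n0 n : (0:R) < n.+1%:R^-1 by rewrite invr_gt0.
  have -> : (\int[s]_y pot M s y = \int[s]_y limn (fun n => tpot M n.+1%:R^-1 s y))%E.
    by apply: eq_integral => y _; apply/esym/cvg_lim => //; exact: tpot_cvg.
  rewrite monotone_convergence//.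
  - apply: lime_le; last by apply: nearW => n; exact: key.
    apply: ereal_nondecreasing_is_cvgn => m n mn; apply: ge0_le_integral => //.
    + by move=> y _; exact: tpot_ge0.
    + exact: measurable_tpot.
    + exact: measurable_tpot.
    + move=> y _; apply: ge0_le_integral => //.
      * by move=> z _; rewrite lee_fin trker_ge0.
      * exact: measurable_trkerE.
      * exact: measurable_trkerE.
      * by move=> z _; rewrite lee_fin trker_decr// lef_pV2 ?posrE// ler_nat.
  - by move=> n; exact: measurable_tpot.
  - by move=> n y _; exact: tpot_ge0.
  - move=> y _ m n mn; apply: ge0_le_integral => //.
    + by move=> z _; rewrite lee_fin trker_ge0.
    + exact: measurable_trkerE.
    + exact: measurable_trkerE.
    + by move=> z _; rewrite lee_fin trker_decr// lef_pV2 ?posrE// ler_nat.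
move=> r0; apply/lee_addgt0Pr => e e0; rewrite -EFinD.
pose Phi y := fine (tpot M r s y).
have PhiE y : tpot M r s y = (Phi y)%:E by rewrite /Phi fineK// tpot_fin.
(* Five errors: the outer average, three in [row] (from [x j] to the net, the inner average, and
   back to [x j]), and the diagonal term [B / n]. *)
have e5 : 0 < e / 5 by lra.
have unif1 f : 0 < f -> exists2 d, 0 < d & forall y z, `|y - z| <= d -> Phi y <= Phi z + f.
  move=> f0; have [d d0 dP] := trker_unif_eps M r0 f0; exists d => // y z yz.
  rewrite -lee_fin EFinD -!PhiE -[f%:E]mule1 -s1 -integral_cst// -ge0_integralD//; last 3 first.
  - by move=> ? _; rewrite lee_fin trker_ge0.
  - exact: measurable_trkerE.
  - by move=> ? _; rewrite lee_fin ltW.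
  apply: ge0_le_integral => //.
  - by move=> ? _; rewrite lee_fin trker_ge0.
  - exact: measurable_trkerE.
  - by apply: emeasurable_funD => //; exact: measurable_trkerE.
  move=> w _; rewrite -EFinD lee_fin; apply: dP; apply: le_trans yz.
  by apply: (le_trans (ler_dist_dist _ _)); rewrite opprB addrA subrK.
have h1 : U [set n | \int[s]_y (Phi y)%:E <=
     ((\sum_(i < n) Phi (x i)) / n%:R + e / 5)%:E]%E.
  apply: sint => //.
  - by move=> y; rewrite fine_ge0// tpot_ge0.
  - by apply: continuous_measurable_fun; exact: continuous_tpot.
have h2 z : U [set n | Phi z <= (\sum_(i < n) trker M r z (x i)) / n%:R + e / 5].
  have := sint (trker M r z) (fun y => trker_ge0 _ _ _ _) (measurable_trker1 _ _ r0).
  move=> /(_ _ _ e5); have hu f : 0 < f -> exists2 d, 0 < d &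
      forall y w, `|y - w| <= d -> trker M r z y <= trker M r z w + f.
    move=> f0; have [d d0 dP] := trker_unif_eps M r0 f0; exists d => // y w yw.
    apply: dP; apply: le_trans yw; rewrite [leRHS]distrC; apply: (le_trans (ler_dist_dist _ _)).
    by rewrite (_ : z - y - (z - w) = w - y)//; ring.
  move=> /(_ hu); apply: filterS => n /=.
  by rewrite -/(tpot M r s z) PhiE lee_fin.
have [d d0 dP] := unif1 _ e5.
have [d' d'0 d'P] := trker_unif_eps M r0 e5.
pose m := Num.min d d'.
have m0 : 0 < m by rewrite lt_min d0.
have [N [t tP]] : exists (N : nat) (t : nat -> R),
    forall y, E y -> exists2 k, (k < N)%N & `|y - t k| <= m.
  have [B [_ /(_ (B + 1))]] := compact_bounded cE; rewrite ltrDl => /(_ ltr01) EB.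
  pose t (k : nat) : R := - (B + 1) + k%:R * m.
  exists (Num.truncn (2 * (B + 1) / m)).+1, t => y Ey.
  have := EB _ Ey; rewrite /= ler_norml => /andP[y1 y2].
  have q0 : 0 <= (y + (B + 1)) / m by rewrite divr_ge0 ?(ltW m0)//; lra.
  exists (Num.truncn ((y + (B + 1)) / m)).
    rewrite ltnS; apply: le_truncn; rewrite ler_pM2r ?invr_gt0//; lra.
  have /andP[k1 k2] := truncn_itv q0.
  rewrite ler_pdivlMr// in k1; rewrite ltr_pdivrMr// -natr1 mulrDl mul1r in k2.
  by rewrite /t ler_norml; apply/andP; split; lra.
have h3 := @filter_forall_lt _ U FU N _ (fun k => h2 (t k)).
pose B := Num.max 0 (M - ln r).
have B0 : 0 <= B by rewrite /B le_max lexx.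
have h4 : U [set n | B / (e / 5) < n%:R].
  apply: ooU; exists (Num.truncn (B / (e / 5))).+1 => // n /= nB.
  by apply: (lt_le_trans (truncnS_gt _)); rewrite ler_nat.
have [n [[/= n1 n3] n4]] := @filter_ex _ U UP _ (filterI (filterI h1 h3) h4).
under eq_integral => y _ do rewrite PhiE.
apply: (le_trans n1); rewrite lee_fin.
have nR : (0:R) < n%:R by apply: le_lt_trans n4; rewrite divr_ge0// ltW.
have row (j : 'I_n) : Phi (x j) <= (\sum_(i < n) trker M r (x j) (x i)) / n%:R + e / 5 *+ 3.
  have [k kN xt] := tP _ (xE j).
  have := n3 _ kN => /= hk.
  have a1 : Phi (x j) <= Phi (t k) + e / 5.
    by apply: dP; rewrite (le_trans xt)// /m ge_min lexx.
  have a2 : (\sum_(i < n) trker M r (t k) (x i)) / n%:R <=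
      (\sum_(i < n) trker M r (x j) (x i)) / n%:R + e / 5.
    rewrite -(ler_pM2r nR) mulrDl !divfK ?gt_eqF//.
    have -> : e / 5 * n%:R = \sum_(i < n) e / 5 by rewrite sumr_const card_ord mulr_natr.
    rewrite -big_split; apply: ler_sum => i _ /=; apply: d'P.
    apply: (le_trans (ler_dist_dist _ _)); rewrite opprB addrA subrK distrC.
    by rewrite (le_trans xt)// /m ge_min lexx orbT.
  lra.
have tot := @leja_sum x c M r E c0 r0 xE EM xc n.
have : (\sum_(j < n) Phi (x j)) / n%:R <= M - ln c + B / n%:R + e / 5 *+ 3.
  rewrite -(ler_pM2r nR) !mulrDl !divfK ?gt_eqF//.
  apply: (@le_trans _ _ (\sum_(j < n) ((\sum_(i < n) trker M r (x j) (x i)) / n%:R + e / 5 *+ 3))).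
    by apply: ler_sum => j _; exact: row.
  rewrite big_split /= sumr_const card_ord -mulr_suml -[X in _ + X <= _]mulr_natr.
  have : (\sum_(i < n) \sum_(j < n) trker M r (x i) (x j)) / n%:R <=
      n%:R * (M - ln c) + B by rewrite ler_pdivrMr// (le_trans tot)// -/B; lra.
  by lra.
have : B / n%:R <= e / 5.
  by rewrite ler_pdivrMr// mulrC -ler_pdivrMr// ltW.
lra.
Qed.

Lemma compact_diam (E : set R) : compact E ->
  exists2 M, 0 <= M & forall x y, E x -> E y -> `|x - y| <= expR M.
Proof.
move=> cE; have [B [_ /(_ (B + 1))]] := compact_bounded cE.
rewrite ltrDl => /(_ ltr01) EB; exists (2 * `|B + 1|) => [|x y Ex Ey].
  by rewrite mulr_ge0.
apply: le_trans (expR_ge1Dx _); apply: (le_trans (ler_normB _ _)).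
have := EB _ Ex; have := EB _ Ey; rewrite /=; have := ler_norm (B + 1); lra.
Qed.

Lemma chebyshev_lt (E : set R) (I c : R) : compact E -> min_energy E = I%:E ->
  expR (- I) < c -> exists Q : {poly R}, [/\ Q \is monic, (1 < size Q)%N &
    forall x, E x -> `|Q.[x]| < c ^+ (size Q).-1].
Proof.
move=> cE EI Ic; have c0 : 0 < c by exact: lt_trans (expR_gt0 _) Ic.
have [M M0 EM] := compact_diam cE.
apply: contrapT => nQ.
have h1 (s : seq R) : s != [::] -> exists x, E x /\ c ^+ size s <= \prod_(y <- s) `|x - y|.
  move=> s0; apply: contrapT => nx; apply: nQ.
  exists (\prod_(y <- s) ('X - y%:P)); rewrite size_prod_XsubC; split => //.
  - exact: monic_prod_XsubC.
  - by rewrite ltnS lt0n size_eq0.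
  - move=> x Ex; rewrite ltNge; apply/negP => h; apply: nx; exists x; split => //.
    apply: (le_trans h); rewrite horner_prod normr_prod.
    by rewrite le_eqVlt; apply/orP; left; apply/eqP/eq_bigr => y _; rewrite hornerXsubC.
have [x xP] : exists x : nat -> R, forall n, E (x n) /\ c ^+ n <= \prod_(i < n) `|x n - x i|.
  (* The empty list would call for a constant polynomial, which [1 < size Q] excludes; there only
     some point of [E] is wanted, and the list [[:: 0]] supplies one. *)
  apply: leja_seq => -[|y s]; last exact: h1.
  have [//|x [Ex _]] := h1 [:: 0].
  by exists x; rewrite big_nil expr0.
have [s [sE sI]] := leja_measure cE c0 (fun n => (xP n).1) EM (fun n => (xP n).2).
have mE : measurable E.
  apply: closed_measurable; apply: compact_closed => //; exact: Rhausdorff.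
have : (min_energy E <= log_energy s)%E by apply: ereal_inf_lbound; exists s.
rewrite EI (log_energyE M0 mE sE EM) => /le_trans/(_ (leeB sI (lexx M%:E))).
rewrite -EFinB lee_fin => h; move: Ic; rewrite -ltr_ln ?posrE ?expR_gt0// expRK; lra.
Qed.

End Chebyshev.

(** * Orthogonal polynomials *)

Section PolynomialFunctional.
Variable R : realType.

(** Factoring out the real roots with multiplicity leaves a polynomial without real roots, of
    constant sign by the intermediate value theorem; multiplying by the same linear factors once
    more turns them into squares. When the list has full length the remaining factor is constant. *)
Lemma poly_sign (p : {poly R}) : p != 0 -> exists rs : seq R,
  [/\ (size rs < size p)%N,
      (forall x, 0 <= (p * \prod_(r <- rs) ('X - r%:P)).[x]) \/
      (forall x, (p * \prod_(r <- rs) ('X - r%:P)).[x] <= 0) &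
      size rs = (size p).-1 -> p = lead_coef p *: \prod_(r <- rs) ('X - r%:P)].
Proof.
move: {2}(size p) (leqnn (size p)) => n; elim: n p => [|n IH] p.
  by rewrite leqn0 size_poly_eq0 => ->.
move=> szp p0; have [[x px]|nr] := pselect (exists x, root p x); last first.
  exists [::]; rewrite big_nil mulr1 /= size_poly_gt0; split => //.
    have np x : p.[x] != 0 by apply/negP => px; apply: nr; exists x.
    have ivt x y : x <= y -> p.[x] <= 0 <= p.[y] -> False.
      by move=> xy /(poly_ivt xy)[z _ pz]; apply: nr; exists z.
    have ivtN x y : x <= y -> p.[y] <= 0 <= p.[x] -> False.
      move=> xy /andP[h1 h2]; have := @poly_ivt R (- p) x y xy.
      rewrite !hornerN oppr_le0 oppr_ge0 h1 h2 => /(_ isT)[z _].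
      by rewrite rootN => pz; apply: nr; exists z.
    have [p00|p00] := leP 0 p.[0]; [left|right] => x.
      rewrite leNgt; apply/negP => px; have [x0|/ltW x0] := leP x 0.
        by apply: (ivt x 0) => //; rewrite p00 ltW.
      by apply: (ivtN 0 x) => //; rewrite p00 ltW.
    rewrite leNgt; apply/negP => px; have [x0|/ltW x0] := leP x 0.
      by apply: (ivtN x 0) => //; rewrite !ltW.
    by apply: (ivt 0 x) => //; rewrite !ltW.
  move=> s0; have : (size p <= 1)%N by move: s0; case: (size p) => //= k <-.
  by move=> /size1_polyC; move: (p`_0) => c ->; rewrite lead_coefC alg_polyC.
have /factor_theorem[p' pE] := px.
have p'0 : p' != 0 by apply: contraNneq p0 => p'0; rewrite pE p'0 mul0r.
have szE : size p = (size p').+1 by rewrite pE size_Mmonic ?monicXsubC// size_XsubC addn2.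
have [|rs [rs1 rs2 rs3]] := IH p' _ p'0; first by rewrite -ltnS -szE.
exists (x :: rs); rewrite big_cons szE /= ltnS; split => //.
- have E : p * (('X - x%:P) * \prod_(r <- rs) ('X - r%:P)) =
     ('X - x%:P) ^+ 2 * (p' * \prod_(r <- rs) ('X - r%:P)) by rewrite pE; ring.
  by case: rs2 => rs2; [left|right] => y; rewrite E hornerM horner_exp;
    [rewrite mulr_ge0 ?sqr_ge0|rewrite mulr_ge0_le0 ?sqr_ge0].
- move=> h; have /rs3 p'E : size rs = (size p').-1 by rewrite -h.
  rewrite {1}pE {1}p'E pE lead_coefM lead_coefXsubC mulr1 -scalerAl.
  by congr (_ *: _); rewrite mulrC.
Qed.

Lemma zero_count_intE (c : R) (rs : seq R) (f : R -> R) : c != 0 ->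
  zero_count_int (c *: \prod_(r <- rs) ('X - r%:P)) f =
  (size rs)%:R^-1 * \sum_(r <- rs) f r.
Proof.
move=> c0; rewrite /zero_count_int size_scale// size_prod_XsubC /=; congr (_ * _).
set q := \prod_(r <- rs) _.
have -> : [set x | root (c *: q) x] = [set` undup rs].
  by apply/seteqP; split => x /=; rewrite rootZ// root_prod_XsubC mem_undup.
rewrite -fsbig_seq ?undup_uniq// -[RHS]big_undup_iterop_count.
apply: eq_bigr => x _; rewrite -mul_polyC mupMr ?rootC//.
by rewrite mu_prod_XsubC mulr_natl.
Qed.

(** The arguments on orthonormal polynomials see the measure only through this positive linear
    functional, later the integral over [E] against [mu]. *)
Variables (L : {poly R} -> R) (E : set R) (p : nat -> {poly R}).
Hypothesis HL : forall a q r, L (a *: q + r) = a * L q + L r.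
Hypothesis Lpos : forall q, (forall x, E x -> 0 <= q.[x]) -> 0 <= L q.
Hypothesis Lbound : forall q : {poly R}, exists B, forall x, E x -> `|q.[x]| <= B.
Hypothesis szp : forall n, size (p n) = n.+1.
Hypothesis ledp : forall n, 0 < lead_coef (p n).
Hypothesis Lort : forall n m, L (p n * p m) = (n == m)%:R.

Let L0 : L 0 = 0.
Proof. by have := HL (-1) 0 0; rewrite scaler0 addr0 mulN1r => ->; rewrite addNr. Qed.

Let LZ a q : L (a *: q) = a * L q.
Proof. by rewrite -[a *: q]addr0 HL L0 addr0. Qed.

Let Lle q r : (forall x, E x -> q.[x] <= r.[x]) -> L q <= L r.
Proof.
move=> h; rewrite -subr_ge0 -mulN1r addrC -HL; apply: Lpos => x Ex.
by rewrite scaleN1r hornerD hornerN addrC subr_ge0 h.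
Qed.

Lemma ortho_lower n (q : {poly R}) : (size q <= n)%N -> L (q * p n) = 0.
Proof.
have : forall k (q : {poly R}), (k <= n)%N -> (size q <= k)%N -> L (q * p n) = 0.
  elim=> [|k IH] {}q kn; first by rewrite leqn0 size_poly_eq0 => /eqP ->; rewrite mul0r.
  move=> sq; pose a := q`_k / lead_coef (p k).
  have qE : q = a *: p k + (q - a *: p k) by rewrite addrC subrK.
  rewrite qE mulrDl -scalerAl HL Lort (_ : k == n = false) ?mulr0 ?add0r; last first.
    by apply/negbTE; rewrite neq_ltn kn.
  apply: IH; first exact: ltnW.
  apply/leq_sizeP => j kj; rewrite coefB coefZ.
  move: kj; rewrite leq_eqVlt => /orP[/eqP <-|kj].
    have -> : (p k)`_k = lead_coef (p k) by rewrite lead_coefE szp.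
    by rewrite /a divfK ?subrr// gt_eqF.
  by rewrite !nth_default ?mulr0 ?subrr ?szp// (leq_trans sq).
by move=> h sq; exact: (h n).
Qed.

Lemma ortho_monic n (T : {poly R}) : T \is monic -> size T = n.+1 ->
  L (T * p n) = (lead_coef (p n))^-1.
Proof.
move=> mT sT; set k := lead_coef _.
have k0 : k != 0 by rewrite gt_eqF//; exact: ledp.
have -> : T = k^-1 *: p n + (T - k^-1 *: p n) by rewrite addrC subrK.
rewrite mulrDl -scalerAl HL Lort eqxx mulr1 ortho_lower ?addr0//.
apply/leq_sizeP => j; rewrite leq_eqVlt coefB coefZ => /orP[/eqP <-|nj].
  have -> : (p n)`_n = k by rewrite /k lead_coefE szp.
  have -> : T`_n = 1 by move/monicP: mT; rewrite lead_coefE sT.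
  by rewrite mulVf// subrr.
by rewrite !nth_default ?mulr0 ?subrr ?szp// sT.
Qed.

(** Expanding [0 <= L ((T - p n / k)^2)], with [k] the leading coefficient of [p n], gives
    [k^-2 <= L (T^2)] because [L (T * p n) = 1 / k]. *)
Lemma ortho_lead_le n (T : {poly R}) (B : R) : T \is monic -> size T = n.+1 ->
  (forall x, E x -> `|T.[x]| <= B) -> (lead_coef (p n)) ^- 2 <= L 1 * B ^+ 2.
Proof.
move=> mT sT TB; set k := lead_coef _.
have k0 : k != 0 by rewrite gt_eqF//; exact: ledp.
have h1 : L (T * T) <= L 1 * B ^+ 2.
  rewrite [leRHS]mulrC -LZ; apply: Lle => x Ex; rewrite hornerM hornerZ hornerC mulr1.
  by rewrite -expr2 -real_normK ?num_real// lerXn2r ?nnegrE// ?(le_trans _ (TB _ Ex))// TB.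
have h2 : 0 <= L ((T - k^-1 *: p n) * (T - k^-1 *: p n)).
  by apply: Lpos => x _; rewrite hornerM -expr2 sqr_ge0.
have E2 : (T - k^-1 *: p n) * (T - k^-1 *: p n) =
    (-2 * k^-1) *: (T * p n) + ((k^-1 * k^-1) *: (p n * p n) + T * T).
  by rewrite -!mul_polyC !rmorphM /= rmorphN rmorph_nat; ring.
move: h2; rewrite E2 !HL ortho_monic// Lort eqxx mulr1 -/k.
rewrite -exprVn expr2 => h2; apply: le_trans h1; lra.
Qed.

(* If [p n] had fewer than [n] real zeros, its product with the linear factors of its real
   zeros would have constant sign while having zero integral. *)
Lemma ortho_split n : exists2 rs : seq R, size rs = n &
  p n = lead_coef (p n) *: \prod_(r <- rs) ('X - r%:P).
Proof.
have pn0 : p n != 0 by rewrite -size_poly_eq0 szp.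
have [rs [rs1 rs2 rs3]] := poly_sign pn0.
suff rsn : size rs = n by exists rs => //; apply: rs3; rewrite szp.
rewrite szp ltnS leq_eqVlt in rs1; case/orP: rs1 => [/eqP //|rs1]; exfalso.
set q := \prod_(r <- rs) _ in rs2 *.
have q0 : q != 0 by rewrite monic_neq0// monic_prod_XsubC.
have Lq : L (p n * q) = 0 by rewrite mulrC ortho_lower// size_prod_XsubC.
have [s [s0 Ls sE]] : exists s : {poly R}, [/\ s != 0, L s = 0 & forall x, 0 <= s.[x]].
  case: rs2 => h; [exists (p n * q)|exists ((-1) *: (p n * q))].
    by split => //; rewrite mulf_neq0.
  split; first by rewrite scaler_eq0 oppr_eq0 oner_eq0 mulf_neq0.
    by rewrite LZ Lq mulr0.
  by move=> x; rewrite hornerZ mulN1r oppr_ge0.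
(* Testing [s] with [p N], [N] the degree of [s]: boundedness of [p N] on [E] and [L s = 0] force
   [L (s * p N) = 0], while orthonormality makes it a nonzero ratio of leading coefficients. *)
pose N := (size s).-1.
have sz : size s = N.+1 by rewrite /N prednK// lt0n size_poly_eq0.
have c0 : lead_coef s != 0 by rewrite lead_coef_eq0.
have : L (((lead_coef s)^-1 *: s) * p N) = (lead_coef (p N))^-1.
  by apply: ortho_monic; rewrite ?size_scale ?invr_eq0// monicE lead_coefZ mulVf.
have [B BP] := Lbound (p N).
rewrite -scalerAl LZ; have -> : L (s * p N) = 0.
  apply/eqP; rewrite eq_le; apply/andP; split.
    have -> : 0 = L (B *: s) by rewrite LZ Ls mulr0.
    apply: Lle => x Ex; rewrite hornerM hornerZ [leRHS]mulrC ler_wpM2l//.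
    by rewrite (le_trans (ler_norm _))// BP.
  have -> : 0 = L ((- B) *: s) by rewrite LZ Ls mulr0.
  apply: Lle => x Ex; rewrite hornerM hornerZ [leLHS]mulrC ler_wpM2l//.
  by have := BP _ Ex; rewrite ler_norml => /andP[].
by rewrite mulr0 => /esym/eqP; rewrite invr_eq0 gt_eqF//; exact: ledp.
Qed.

(* Test the minimality of [p n] on [Q ^+ k * 'X^r] with [n = k * deg Q + r]. *)
Lemma ortho_lead_growth (Q : {poly R}) (c : R) : 0 < c ->
  Q \is monic -> (1 < size Q)%N -> (forall x, E x -> `|Q.[x]| <= c ^+ (size Q).-1) ->
  exists2 K, 0 < K & forall n, (lead_coef (p n))^-1 <= K * c ^+ n.
Proof.
move=> c0 mQ sQ QE; have [D DP] := Lbound 'X.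
pose d := (size Q).-1; have d0 : (0 < d)%N by rewrite /d; case: (size Q) sQ => [|[]].
have L10 : 0 <= L 1 by apply: Lpos => x _; rewrite hornerC.
(* Chosen so that [|x| <= D' c] on [E] and [1 <= D']: the factor ['X^r] with [r < d] then costs at
   most [D' ^+ d * c ^+ r]. *)
pose D' := 1 + `|D| / c.
have D'1 : 1 <= D' by rewrite lerDl divr_ge0// ltW.
pose S := Num.sqrt (L 1).
exists (S * D' ^+ d + 1) => [|n].
  by rewrite ltr_wpDl// mulr_ge0 ?sqrtr_ge0// exprn_ge0// (le_trans _ D'1).
pose T := Q ^+ (n %/ d) * 'X^(n %% d).
have mT : T \is monic by rewrite monicMl ?monic_exp ?monicX.
have sT : size T = n.+1.
  rewrite size_monicM ?monic_exp// -?size_poly_eq0 ?size_polyXn//.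
  have sQn : (0 < size (Q ^+ (n %/ d)))%N.
    by rewrite lt0n size_poly_eq0 monic_neq0// monic_exp.
  by rewrite -(prednK sQn) addnS /= addSn size_exp -/d mulnC -divn_eq.
have TB x : E x -> `|T.[x]| <= D' ^+ d * c ^+ n.
  move=> Ex; rewrite hornerM !horner_exp hornerX normrM !normrX.
  rewrite [in X in _ <= X](divn_eq n d) exprD mulrCA [(n %/ d * d)%N]mulnC exprM.
  apply: ler_pM; rewrite ?exprn_ge0//.
    by apply: lerXn2r; rewrite ?nnegrE ?exprn_ge0 ?(ltW c0)//; exact: QE.
  apply: (@le_trans _ _ ((D' * c) ^+ (n %% d))).
    apply: lerXn2r; rewrite ?nnegrE ?mulr_ge0 ?(ltW c0) ?(le_trans _ D'1)//.
    have := DP _ Ex; rewrite hornerX => h.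
    rewrite /D' mulrDl mul1r divfK ?gt_eqF// (le_trans h)// (le_trans (ler_norm _))//.
    by rewrite lerDr ltW.
  rewrite exprMn ler_wpM2r ?exprn_ge0 ?(ltW c0)//.
  by apply: ler_weXn2l => //; exact/ltnW/ltn_pmod.
have := ortho_lead_le mT sT TB.
set k := lead_coef _ => h.
have k0 : 0 <= k^-1 by rewrite invr_ge0 ltW//; exact: ledp.
have B0 : 0 <= D' ^+ d * c ^+ n.
  by rewrite mulr_ge0 ?exprn_ge0 ?(ltW c0)// (le_trans _ D'1).
have D'd : 0 <= D' ^+ d by rewrite exprn_ge0// (le_trans _ D'1).
have cn0 : 0 <= c ^+ n by rewrite exprn_ge0// ltW.
have : k^-1 <= S * (D' ^+ d * c ^+ n).
  rewrite -(@ler_pXn2r _ 2)// ?nnegrE ?mulr_ge0 ?sqrtr_ge0//.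
  by rewrite exprVn exprMn sqr_sqrtr.
move=> /le_trans; apply; rewrite mulrA mulrDl mul1r lerDl exprn_ge0//; exact: ltW.
Qed.

End PolynomialFunctional.

(** Comparing coefficients of degree [n.+1] in the recurrence gives [lead_coef (p n) = a n.+1 *
    lead_coef (p n.+1)]. The constant [lead_coef (p 0)] stays because the measure may have mass
    other than one; it disappears in the [n]-th root. *)
Lemma jacobi_lead (R : realType) (p : nat -> {poly R}) (a b : nat -> R) :
  (forall n, size (p n) = n.+1) -> jacobi_params p a b ->
  forall n, lead_coef (p n) * \prod_(1 <= i < n.+1) a i = lead_coef (p 0%N).
Proof.
move=> szp [a0 rec]; elim=> [|n IH]; first by rewrite big_nil mulr1.
rewrite big_nat_recr//= -IH mulrCA [RHS]mulrC; congr (_ * _).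
have [z [zE z0]] : exists z : {poly R},
    'X * p n = a n.+1 *: p n.+1 + b n.+1 *: p n + z /\ z`_n.+1 = 0.
  eexists; split; first exact: rec.
  by case: n {IH} => [|k]; rewrite ?coef0// coefZ nth_default ?mulr0// szp leqW.
have := congr1 (fun q : {poly R} => q`_n.+1) zE.
rewrite coefXM /= !coefD !coefZ z0 addr0 (_ : (p n)`_n.+1 = 0); last first.
  by rewrite nth_default// szp.
by rewrite mulr0 addr0 !lead_coefE !szp /= => ->; rewrite mulrC.
Qed.

(** * Polynomials that are small on a set of positive capacity *)

Section Capacity.
Variable R : realType.

Lemma cvg_near_le (f : nat -> R) (l e : R) : f @ \oo --> l -> 0 < e ->
  \forall n \near \oo, `|l - f n| <= e.
Proof. by move=> /cvgrPdist_le h e0; exact: h. Qed.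

Lemma lk_split (M r x y : R) : 0 < r -> r <= expR M ->
  lk M x y = ((trker M r x y)%:E + lk (ln r) x y)%E.
Proof.
move=> r0 rM; have [->|xy] := eqVneq x y; first by rewrite !lk_diag addey.
have lM : ln r <= M by rewrite -ler_expR lnK ?posrE.
have d0 : 0 < `|x - y| by rewrite normr_gt0 subr_eq0.
rewrite !lk_neq// -EFinD /trker; congr EFin; have [h|h] := leP r `|x - y|.
  by rewrite [Num.max 0 (ln r - _)]max_l ?addr0// subr_le0 ler_ln// posrE.
have lr : ln `|x - y| <= ln r by rewrite ler_ln ?posrE// ltW.
by rewrite !max_r ?subr_ge0//; [ring|exact: le_trans lM].
Qed.

(** Truncated energies increase to the energy by monotone convergence; the limit being finite, the
    difference, which [lk_split] identifies with the energy of the tail kernel, tends to zero. *)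
Lemma pot_tail (M e : R) (nu : probability R R) : 0 < e ->
  (\int[nu]_x pot M nu x < +oo)%E ->
  exists2 r, 0 < r & (\int[nu]_x pot (ln r) nu x <= e%:E)%E.
Proof.
move=> e0 fin; have n0 n : (0:R) < n.+1%:R^-1 by rewrite invr_gt0.
have cv : (fun n => \int[nu]_x tpot M n.+1%:R^-1 nu x)%E @ \oo --> (\int[nu]_x pot M nu x)%E.
  have -> : (\int[nu]_y pot M nu y = \int[nu]_y limn (fun n => tpot M n.+1%:R^-1 nu y))%E.
    by apply: eq_integral => y _; apply/esym/cvg_lim => //; exact: tpot_cvg.
  apply: cvg_monotone_convergence => //.
  - by move=> n; exact: measurable_tpot.
  - by move=> n y _; exact: tpot_ge0.
  - move=> y _ m n mn; apply: ge0_le_integral => //.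
    + by move=> z _; rewrite lee_fin trker_ge0.
    + exact: measurable_trkerE.
    + exact: measurable_trkerE.
    + by move=> z _; rewrite lee_fin trker_decr// lef_pV2 ?posrE// ler_nat.
have I0 : (0 <= \int[nu]_x pot M nu x)%E by apply: integral_ge0 => x _; exact: pot_ge0.
pose a := fine (\int[nu]_x pot M nu x)%E.
have aE : (\int[nu]_x pot M nu x = a%:E)%E by rewrite fineK// ge0_fin_numE.
rewrite aE in cv; have /fine_cvgP[f1 f2] := cv.
have f3 := cvg_near_le f2 e0.
have f4 : \forall n \near \oo, n.+1%:R^-1 <= expR M.
  exists (Num.truncn (expR (- M))).+1 => // n /= nM.
  rewrite -[expR M]invrK -expRN lef_pV2 ?posrE ?expR_gt0//.
  apply/ltW/(lt_le_trans (truncnS_gt _)); rewrite ler_nat.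
  by rewrite (leq_trans nM).
have [n [[/= h1 h3] h4]] := filter_ex (filterI (filterI f1 f3) f4).
exists n.+1%:R^-1 => //.
have : (\int[nu]_x pot M nu x = \int[nu]_x tpot M n.+1%:R^-1 nu x +
    \int[nu]_x pot (ln n.+1%:R^-1) nu x)%E.
  rewrite -ge0_integralD//; last 4 first.
  - by move=> x _; exact: tpot_ge0.
  - exact: measurable_tpot.
  - by move=> x _; exact: pot_ge0.
  - exact: measurable_pot.
  apply: eq_integral => x _; rewrite /pot /tpot -ge0_integralD//; last 4 first.
  - by move=> y _; rewrite lee_fin trker_ge0.
  - exact: measurable_trkerE.
  - by move=> y _; exact: lk_ge0.
  - exact: measurable_lk1.
  by apply: eq_integral => y _; exact: lk_split.
rewrite aE; move: h1 h3.
have : (0 <= \int[nu]_x pot (ln n.+1%:R^-1) nu x)%E by apply: integral_ge0 => x _; exact: pot_ge0.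
case: (\int[nu]_x tpot _ _ _ _)%E => // b; case: (\int[nu]_x pot (ln _) _ _)%E => [c| |]//= _ _.
by rewrite ler_norml => /andP[h5 h6] [h7]; rewrite lee_fin; lra.
Qed.

(** Dropping positive parts turns the sum into [- ln] of the product. An upper bound on a polynomial
    at [x] thus becomes a lower bound on the potential of its zeros; at a zero the sum is
    infinite. *)
Lemma sum_lk_ge (M T x : R) (rs : seq R) : 0 < T ->
  \prod_(r <- rs) `|x - r| <= T ->
  (((size rs)%:R * M - ln T)%:E <= \sum_(r <- rs) lk M x r)%E.
Proof.
move=> T0 PT; have [xrs|xrs] := boolP (x \in rs).
  suff -> : (\sum_(r <- rs) lk M x r = +oo)%E by rewrite leey.
  rewrite (big_rem x xrs)/= lk_diag addye// gt_eqF// (lt_le_trans (ltNyr 0))//.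
  by apply: sume_ge0 => r _; exact: lk_ge0.
suff h : (\sum_(r <- rs) lk M x r >= ((size rs)%:R * M - ln (\prod_(r <- rs) `|x - r|))%:E)%E /\
    0 < \prod_(r <- rs) `|x - r|.
  case: h => h P0; apply: le_trans h; rewrite lee_fin lerD2l lerN2 ler_ln ?posrE//.
elim: rs xrs {PT} => [|r rs IH]; first by rewrite !big_nil ln1 mul0r subr0.
rewrite inE negb_or => /andP[xr /IH[h P0]]; rewrite !big_cons /=.
have d0 : 0 < `|x - r| by rewrite normr_gt0 subr_eq0.
split; last by rewrite mulr_gt0.
rewrite lnM ?posrE// -natr1.
have -> : ((size rs)%:R + 1) * M - (ln `|x - r| + ln (\prod_(j <- rs) `|x - j|)) =
  (M - ln `|x - r|) + ((size rs)%:R * M - ln (\prod_(j <- rs) `|x - j|)) by ring.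
rewrite EFinD; apply: leeD => //.
by rewrite lk_neq// lee_fin le_max lexx orbT.
Qed.

(* The contradiction comes from integrating the potentials of the zeros against [nu]
   restricted to a closed set on which its truncated potentials converge uniformly. *)
Lemma finite_energy_contra (E : set R) (M I D K : R) (rho nu : probability R R)
    (q : nat -> {poly R}) (c : nat -> R) (rs : nat -> seq R)
    (X : nat -> set R) (J : nat -> Prop) :
  compact E -> 0 <= M -> (forall x y, E x -> E y -> `|x - y| <= expR M) ->
  min_energy E = I%:E -> equilibrium E rho ->
  (forall j, c j != 0) -> (forall j, q j = c j *: \prod_(r <- rs j) ('X - r%:P)) ->
  (forall j, (j <= size (rs j))%N) -> zeros_weak_cvg q rho ->
  (forall N, closed (X N)) -> (forall N x, X N x -> X N.+1 x) ->
  (forall N, X N `<=` E) -> (forall N, exists2 j, (N <= j)%N & J j) ->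
  0 < D -> ln D < - I -> 0 < K ->
  (forall N j x, X N x -> (N <= j)%N -> J j ->
     \prod_(r <- rs j) `|x - r| <= K * D ^+ size (rs j)) ->
  nu (~` \bigcup_N X N) = 0%E -> (log_energy nu < +oo)%E -> False.
Proof.
move=> cE M0 EM EI [rhoE rhoI] c0 qE szrs zcv cX mX XE Jinf D0 DI K0 hX nuX nufin.
have mE : measurable E by exact: compact_measurable.
have mXN N : measurable (X N) by exact: closed_measurable.
have mUX : measurable (\bigcup_N X N) by exact: bigcup_measurable.
have nuE : nu (~` E) = 0%E.
  apply: (subset_measure0 _ _ _ nuX); [exact: measurableC|exact: measurableC|].
  by apply: subsetC => x [N _]; exact: XE.
have hmin (n : probability R R) : n (~` E) = 0%E -> ((M + I)%:E <= \int[n]_x pot M n x)%E.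
  move=> nE; have : (I%:E <= log_energy n)%E by rewrite -EI; apply: ereal_inf_lbound; exists n.
  by rewrite (log_energyE M0 mE nE EM) leeBrDr// -EFinD addrC.
have rhoM : (\int[rho]_x pot M rho x = (M + I)%:E)%E.
  move: rhoI; rewrite EI (log_energyE M0 mE rhoE EM).
  case: (\int[rho]_x pot M rho x)%E => //= a [<-]; congr EFin; ring.
have MI0 : 0 <= M + I.
  by rewrite -lee_fin -rhoM; apply: integral_ge0 => x _; exact: pot_ge0.
have frost := frostman MI0 hmin mE rhoE rhoM.
pose g := - ln D - I; have g0 : 0 < g by rewrite /g; lra.
(* The estimates end with [g * m <= 3 * e] for some [m >= 1 / 2], which this value contradicts. *)
pose e := g / 16; have e0 : 0 < e by rewrite /e; lra.
have nuM : (\int[nu]_x pot M nu x < +oo)%E.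
  move: nufin; rewrite (log_energyE M0 mE nuE EM).
  by case: (\int[nu]_x pot M nu x)%E => //= a _; rewrite ltry.
have e4 : 0 < e / 4 by lra.
(* With tail energy at most [e / 4], Markov's inequality lets the tail potential exceed [e] on mass
   at most [1 / 4]; another [1 / 4] is lost in passing to [X N], which leaves mass at least
   [1 / 2]. *)
have [r r0 rtail] := pot_tail e4 nuM.
pose F := [set x | pot (ln r) nu x <= e%:E]%E.
have cF : closed F by exact: closed_pot_le.
have mF : measurable F by exact: closed_measurable.
have nuF : (nu (~` F) <= (4^-1)%:E)%E.
  have : (e%:E * nu (~` F) <= (e / 4)%:E)%E.
    apply: le_trans rtail; rewrite -integral_cst; last exact: measurableC.
    apply: (@le_trans _ _ (\int[nu]_(x in ~` F) pot (ln r) nu x)%E).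
      apply: ge0_le_integral => //.
      - exact: measurableC.
      - by move=> x _; rewrite lee_fin ltW.
      - by apply: measurable_funTS; exact: measurable_pot.
      - by move=> x /= /negP; rewrite -ltNge => /ltW.
    apply: ge0_subset_integral => //; [exact: measurableC|exact: measurable_pot|].
    by move=> x _; exact: pot_ge0.
  have : nu (~` F) \is a fin_num by rewrite fin_num_measure//; exact: measurableC.
  case: (nu (~` F)) => // f _; rewrite -EFinM !lee_fin => h.
  by rewrite -(ler_pM2l e0).
have [N nuN] : exists N, ((4^-1)%:E >= nu (~` X N))%E.
  have ndX : {homo X : n m / (n <= m)%N >-> (n <= m)%O}.
    apply: homo_leq => //; first exact: le_trans.
    by move=> n; apply/subsetPset => x; exact: mX.
  have nuU : nu (\bigcup_N X N) = 1%E.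
    have := probability_setC nu (measurableC mUX); rewrite setCK => ->.
    by rewrite nuX sube0.
  have : (fun N => nu (X N)) @ \oo --> 1%:E.
    by rewrite -nuU; exact: (nondecreasing_cvg_mu (mu := nu) mXN mUX ndX).
  move=> /fine_cvgP[_ f2]; have q4 : (0:R) < 4^-1 by [].
  have [N /= hN] := filter_ex (cvg_near_le f2 q4); exists N.
  rewrite probability_setC// -[nu (X N)]fineK ?fin_num_measure// -EFinB lee_fin.
  exact: le_trans (ler_norm _) hN.
pose F' := F `&` X N.
have cF' : closed F' by exact: closedI.
have mF' : measurable F' by exact: closed_measurable.
have [t tE] := restrict_measure nu mF'.
pose m := fine (nu F').
have mE' : t setT = m%:E by rewrite tE setTI fineK// fin_num_measure.
have m1 : m <= 1 by rewrite -lee_fin -mE' tE setTI probability_le1.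
have m2 : 2^-1 <= m.
  have : (nu (~` F') <= (4^-1)%:E + (4^-1)%:E)%E.
    rewrite setCI; apply: (le_trans (measureU2 _ _ _)); try exact: measurableC.
    exact: leeD.
  rewrite probability_setC// -[nu F']fineK ?fin_num_measure// -/m -EFinB -EFinD lee_fin; lra.
have tF' : t (~` F') = 0%E by rewrite tE setICl measure0.
have intt f (mf : measurable_fun setT f) (f0 : forall x, (0 <= f x)%E) :=
  integral_restrict mF' tE mf f0.
have tle f : measurable_fun setT f -> (forall x, 0 <= f x)%E ->
    (\int[t]_x f x <= \int[nu]_x f x)%E.
  by move=> mf f0; rewrite intt//; apply: ge0_subset_integral.
(* The restriction [t] lies below [nu], so its tail potential is at most [e] on the closed set [F']
   carrying it; the maximum principle extends this to the zeros, wherever they lie. *)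
have tpotF x : (pot (ln r) t x <= e%:E)%E.
  apply: (maximum_principle cF' tF' (ltW e0)) => {}x [Fx _].
  apply: le_trans Fx; apply: tle; first exact: measurable_lk1.
  by move=> y; exact: lk_ge0.
pose f y := fine (tpot M r t y).
have fE y : tpot M r t y = (f y)%:E by rewrite fineK// tpot_fin.
have f0 y : 0 <= f y by rewrite fine_ge0// tpot_ge0.
have fcont : continuous f by exact: continuous_tpot.
have fbound : exists B, forall y, `|f y| <= B.
  exists (Num.max 0 (M - ln r) * m) => y; rewrite ger0_norm// -lee_fin -fE EFinM -mE'.
  exact: tpot_le.
(* By symmetry the integral of [pot M t] against [rho] is that of [pot M rho] against [t], to which
   Frostman's bound applies. *)
have frho : (\int[rho]_y (f y)%:E <= ((M + I) * m)%:E)%E.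
  apply: (@le_trans _ _ (\int[rho]_y pot M t y)%E).
    apply: ge0_le_integral => //.
    - by move=> y _; rewrite lee_fin.
    - by apply/measurable_EFinP; exact: continuous_measurable_fun.
    - exact: measurable_pot.
    - by move=> y _; rewrite -fE tpot_le_pot.
  rewrite pot_sym EFinM -mE' -integral_cst//; apply: ge0_le_integral => //.
  - by move=> y _; exact: pot_ge0.
  - exact: measurable_pot.
have := zcv f fcont fbound.
pose a := fine (\int[rho]_y (f y)%:E)%E.
have -> : (\int[rho]_y (f y)%:E = a%:E)%E.
  rewrite fineK// ge0_fin_numE ?(le_lt_trans frho) ?ltry//.
  by apply: integral_ge0 => y _; rewrite lee_fin.
have aI : a <= (M + I) * m.
  rewrite -lee_fin fineK// ge0_fin_numE ?(le_lt_trans frho) ?ltry//.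
  by apply: integral_ge0 => y _; rewrite lee_fin.
move=> /fine_cvgP[_ zc].
have z1 := cvg_near_le zc e0.
have z2 : \forall j \near \oo, `|ln K| / e < j%:R.
  exists (Num.truncn (`|ln K| / e)).+1 => // j /= jn.
  by apply: (lt_le_trans (truncnS_gt _)); rewrite ler_nat.
have [N1 _ hN1] := filterI z1 z2.
have [j jN Jj] := Jinf (maxn N N1).
have [/= z1j z2j] := hN1 j (leq_trans (leq_maxr _ _) jN).
have {}jN : (N <= j)%N := leq_trans (leq_maxl _ _) jN.
pose n : R := (size (rs j))%:R.
have jn : j%:R <= n by rewrite ler_nat.
have j0 : (0:R) < j%:R by apply: le_lt_trans z2j; rewrite divr_ge0// ltW.
have n0 : 0 < n by exact: lt_le_trans jn.
pose T := K * D ^+ size (rs j).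
have T0 : 0 < T by rewrite mulr_gt0 ?exprn_gt0.
have lT : ln T = ln K + n * ln D.
  by rewrite lnM ?posrE ?exprn_gt0// lnXn// -mulr_natl.
pose S := n * M - ln T.
(* [sum_lk_ge] is integrated over [F'], of mass [m], after replacing [S] by its positive part to
   stay with nonnegative integrands; the potential of [t] at each zero is then split into truncation
   [f] and tail. *)
have key : S * m <= \sum_(z <- rs j) (f z + e).
  apply: (@le_trans _ _ (Num.max 0 S * m)).
    by rewrite ler_wpM2r ?le_max ?lexx ?orbT//; lra.
  rewrite -lee_fin EFinM -mE' -integral_cst// -sumEFin.
  apply: (@le_trans _ _ (\int[t]_x \sum_(z <- rs j) lk M x z)%E).
    rewrite (integral_concentrated mF' tF')//; last by move=> x; rewrite lee_fin le_max lexx.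
    have ms : measurable_fun [set: R] (fun x => \sum_(z <- rs j) lk M x z)%E.
      apply: emeasurable_sum => z.
      by apply: eq_measurable_fun (measurable_lk1 M z) => x _; rewrite lkC.
    have s0 x : (0 <= \sum_(z <- rs j) lk M x z)%E.
      by apply: sume_ge0 => z _; exact: lk_ge0.
    rewrite (integral_concentrated mF' tF' ms s0).
    apply: ge0_le_integral => //.
    - by move=> x _; rewrite lee_fin le_max lexx.
    - exact: measurable_funTS.
    - move=> x [_ Xx]; rewrite EFin_max ge_max s0 /=; apply: sum_lk_ge => //.
      exact: hX Xx jN Jj.
  rewrite ge0_integral_sum//; last 2 first.
  - by move=> z; apply: eq_measurable_fun (measurable_lk1 M z) => x _; rewrite lkC.
  - by move=> z x _; exact: lk_ge0.
  apply: lee_sum => z _; apply: (@le_trans _ _ (pot M t z)).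
    by rewrite le_eqVlt; apply/orP; left; apply/eqP/eq_integral => x _; rewrite lkC.
  rewrite EFinD -fE; apply: (@le_trans _ _ (tpot M r t z + pot (ln r) t z)%E); last exact: leeD.
  rewrite /pot /tpot -ge0_integralD//; last 4 first.
  - by move=> y _; rewrite lee_fin trker_ge0.
  - exact: measurable_trkerE.
  - by move=> y _; exact: lk_ge0.
  - exact: measurable_lk1.
  apply: ge0_le_integral => //.
  - by move=> y _; exact: lk_ge0.
  - exact: measurable_lk1.
  - by apply: emeasurable_funD; [exact: measurable_trkerE|exact: measurable_lk1].
  - by move=> y _; exact: lk_le_trker.
move: key; rewrite big_split /= big_const_seq count_predT iter_addr_0 -[e *+ _]mulr_natl -/n => key.
move: z1j; rewrite qE zero_count_intE// -/n ler_norml => /andP[z1j _].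
have sn : \sum_(z <- rs j) f z <= n * (a + e).
  by rewrite mulrC -ler_pdivrMr// mulrC; lra.
have lnKn : ln K <= n * e.
  rewrite (le_trans (ler_norm _))// mulrC -ler_pdivrMl// mulrC.
  by rewrite (le_trans (ltW z2j)).
have : n * ((M - ln D - e) * m) <= n * (a + 2 * e).
  apply: (@le_trans _ _ (S * m)); last by lra.
  rewrite mulrA ler_wpM2r//; first by lra.
  by rewrite /S lT; lra.
rewrite ler_pM2l// => fin.
have : g * m <= 3 * e by rewrite /g; nra.
by rewrite /e; nra.
Qed.

End Capacity.

(** * Root asymptotics of the leading coefficients *)

Section RootAsymptotics.
Variable R : realType.

(** Every point outside the support has a null neighbourhood, hence lies in a null interval with
    rational end points; there are countably many of these, enumerated through [unpickle]. *)
Lemma msupport_null (mu : {measure set R -> \bar R}) :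
  measurable (msupport mu) -> mu (~` msupport mu) = 0%E.
Proof.
move=> mS; apply/negligibleP; first exact: measurableC.
pose I (q : rat * rat) : set R := `]ratr q.1, ratr q.2[%classic.
pose F k := if unpickle k is Some q then if mu (I q) == 0%E then I q else set0 else set0.
apply: (@negligibleS _ _ _ _ (\bigcup_k F k)); last first.
  apply: negligible_bigcup => k; rewrite /F; case: unpickle => [q|]; last exact: negligible_set0.
  case: eqP => [q0|_]; last exact: negligible_set0.
  by apply/negligibleP => //; exact: measurable_itv.
move=> x nx; have [U [oU Ux U0]] : exists U, [/\ open U, U x & mu U = 0%E].
  apply: contrapT => h; apply: nx => U oU Ux; rewrite lt_neqAle measure_ge0 andbT.
  by apply/eqP => U0; apply: h; exists U.
have := open_nbhs_nbhs (conj oU Ux) => /nbhs_ballP[e /= e0 eU].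
have [q1] := @rat_in_itvoo R (x - e) x (ltac:(by rewrite ltrBlDr ltrDl)).
rewrite in_itv /= => /andP[q1a q1b].
have [q2] := @rat_in_itvoo R x (x + e) (ltac:(by rewrite ltrDl)).
rewrite in_itv /= => /andP[q2a q2b].
have [k kE] : exists k, unpickle k = Some (q1, q2).
  by exists (pickle (q1, q2)); exact: pickleK.
exists k; first exact: Logic.I.
rewrite /F kE.
have -> : mu (I (q1, q2)) = 0%E.
  apply: subset_measure0 U0; [exact: measurable_itv|exact: open_measurable|].
  move=> y; rewrite /I /= in_itv /= => /andP[y1 y2]; apply: eU.
  by rewrite /ball /= ltr_norml; apply/andP; split; lra.
by rewrite eqxx /I /= in_itv /= q1b q2a.
Qed.

Lemma integral_null_setC (mu : {measure set R -> \bar R}) (E : set R) (f : R -> \bar R) :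
  measurable E -> mu (~` E) = 0%E -> measurable_fun setT f ->
  (\int[mu]_x f x = \int[mu]_(x in E) f x)%E.
Proof.
move=> mE E0 mf; rewrite [LHS]integralE [RHS]integralE.
by congr (_ - _)%E; apply: integral_concentrated => //;
  [exact: measurable_funepos|exact: measurable_funeneg].
Qed.

Lemma poly_bounded (E : set R) (q : {poly R}) : compact E ->
  exists B : R, forall x, E x -> `|q.[x]| <= B.
Proof.
move=> cE; have /compact_bounded[B [_ /(_ (B + 1))h]] : compact (horner q @` E).
  apply: continuous_compact => //; apply: continuous_subspaceT; exact: continuous_horner.
exists (B + 1) => x Ex; apply: h; first by rewrite ltrDl.
by exists x.
Qed.

Lemma measurable_horner (q : {poly R}) (E : set R) :
  measurable_fun E (horner q).
Proof.
by apply: measurable_funTS; apply: continuous_measurable_fun; exact: continuous_horner.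
Qed.

Lemma root_le n (w d : R) : (0 < n)%N -> 0 <= w -> 0 <= d ->
  (w `^ n%:R^-1 <= d) = (w <= d ^+ n).
Proof.
move=> n0 w0 d0.
have wE : w = (w `^ n%:R^-1) ^+ n.
  by rewrite -powR_mulrn ?powR_ge0// -powRrM mulVf ?powRr1// pnatr_eq0 -lt0n.
by rewrite [in RHS]wE ler_pXn2r// nnegrE powR_ge0.
Qed.

(** Since [K (c / d)^n] tends to zero, a larger base absorbs the constant factor. *)
Lemma exp_root_le (w : nat -> R) (n : nat -> nat) (K c d : R) :
  0 < c -> c < d -> 0 < K -> (forall j, (j <= n j)%N) ->
  (forall j, 0 <= w j <= K * c ^+ n j) ->
  \forall j \near \oo, w j `^ (n j)%:R^-1 <= d.
Proof.
move=> c0 cd K0 jn wK; have d0 := lt_trans c0 cd.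
have z1 : `|c / d| < 1 by rewrite ger0_norm ?divr_ge0 ?ltW// ltr_pdivrMr// mul1r.
have Kc := cvg_near_le (cvg_expr z1) (ltac:(by rewrite invr_gt0) : 0 < K^-1).
have [N _ hN] := Kc; exists N.+1 => // j /= Nj.
have /andP[w0 wj] := wK j.
have Nn : (N <= n j)%N by rewrite (leq_trans (ltnW Nj)).
have n0 : (0 < n j)%N by rewrite (leq_trans _ (jn j))// (leq_trans _ Nj).
rewrite root_le// ?(ltW d0)//.
apply: (le_trans wj); have := hN _ Nn; rewrite /= sub0r normrN ger0_norm; last first.
  by rewrite exprn_ge0// divr_ge0// ltW.
by rewrite expr_div_n ler_pdivrMr ?exprn_gt0// mulrC ler_pdivlMr// mulrC.
Qed.

(** Positive capacity excludes [+oo]; [-oo] is excluded because the minimum is attained and an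
    energy on a set of diameter at most [expR M] is at least [- M]. *)
Lemma cap_compact_fin (E : set R) (rho : probability R R) :
  compact E -> (0 < cap_compact E)%E -> equilibrium E rho ->
  exists2 I, min_energy E = I%:E & cap_compact E = (expR (- I))%:E.
Proof.
move=> cE + [rhoE rhoI]; rewrite /cap_compact.
have [M M0 EM] := compact_diam cE.
move: rhoI; rewrite (log_energyE M0 (compact_measurable cE) rhoE EM).
have : (0 <= \int[rho]_x pot M rho x)%E by apply: integral_ge0 => x _; exact: pot_ge0.
case: (min_energy E) => [I| |]; [by exists I|by rewrite ltxx|].
by case: (\int[rho]_x pot M rho x)%E.
Qed.

Lemma capacity_eq0 (X : set R) :
  (forall nu : probability R R, nu (~` X) = 0%E -> (log_energy nu < +oo)%E -> False) ->
  measurable X -> capacity X = 0%E.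
Proof.
move=> h mX; have h0 (K : set R) : compact K -> K `<=` X -> cap_compact K = 0%E.
  move=> cK KX; suff -> : cap_compact K = 0%E by [].
  rewrite /cap_compact; suff -> : min_energy K = +oo%E by [].
  apply/eqP; rewrite -leye_eq; apply: le_ereal_inf_tmp => _ [nu nuK <-].
  rewrite leye_eq -leye_eq leNgt; apply/negP => /(h nu); apply.
  apply: subset_measure0 nuK; [exact: measurableC| |exact: subsetC].
  by apply: measurableC; exact: compact_measurable.
apply/eqP; rewrite eq_le; apply/andP; split.
  by apply: ge_ereal_sup => _ [K [cK KX] <-]; rewrite h0.
(* The compact set [set0] makes the family nonempty, so its supremum is not [-oo]. *)
by apply: ereal_sup_ubound; exists set0; [split => //; exact: compact0|rewrite h0//; exact: compact0].
Qed.

Lemma setC_horner_gt (q : {poly R}) (t : R) :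
  ~` [set x | t < `|q.[x]|] = [set x | `|q.[x]| <= t].
Proof.
by apply/seteqP; split => x /=; [move=> h; rewrite leNgt; apply/negP|rewrite leNgt => /negP].
Qed.

Lemma closed_horner_le (q : {poly R}) (t : R) : closed [set x | `|q.[x]| <= t].
Proof.
rewrite -[X in closed X]/((fun x => `|q.[x]|) @^-1` [set y | y <= t]).
apply: closed_comp => [x _|]; last exact: closed_le.
apply: (@continuous_comp _ _ _ (horner q)); first exact: continuous_horner.
exact: norm_continuous.
Qed.

Lemma measurable_horner_gt (q : {poly R}) (t : R) : measurable [set x | t < `|q.[x]|].
Proof.
have -> : [set x | t < `|q.[x]|] = ~` [set x | `|q.[x]| <= t].
  by rewrite -setC_horner_gt setCK.
by apply: measurableC; apply: closed_measurable; exact: closed_horner_le.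
Qed.

Section Functional.
Variables (mu : {finite_measure set R -> \bar R}) (E : set R) (p : nat -> {poly R}).
Hypotheses (cE : compact E) (muE : mu (~` E) = 0%E) (op : orthonormal_polys mu p).

Let mE : measurable E := compact_measurable cE.
Let L (q : {poly R}) := (\int[mu]_(x in E) q.[x])%R.

Let integrable_poly q : mu.-integrable E (EFin \o horner q).
Proof.
apply: measurable_bounded_integrable => //.
- by rewrite ltey_eq fin_num_measure.
- exact: measurable_horner.
have [B hB] := poly_bounded q cE; exists B; split; first exact: num_real.
by move=> y By x Ex /=; rewrite (le_trans (hB x Ex))// ltW.
Qed.

Let HL a q r : L (a *: q + r) = a * L q + L r.
Proof.
rewrite /L -RintegralZl; [|exact: mE|exact: integrable_poly].
rewrite -RintegralD; [|exact: mE| |exact: integrable_poly]; last first.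
  by apply: eq_integrable (integrable_poly (a *: q)) => // x _ /=; rewrite hornerZ.
by apply: eq_Rintegral => x _; rewrite hornerD hornerZ.
Qed.

Let Lpos q : (forall x, E x -> 0 <= q.[x]) -> 0 <= L q.
Proof. by move=> h; apply: Rintegral_ge0. Qed.

Let Lort n m : L (p n * p m) = (n == m)%:R.
Proof.
rewrite /L /Rintegral; have [_ [_ /(_ n m)]] := op.
rewrite (integral_null_setC mE muE) => [h|]; last first.
  apply/measurable_EFinP; apply: (eq_measurable_fun (horner (p n * p m))).
    by move=> x _; rewrite hornerM.
  exact: measurable_horner.
rewrite -[RHS]/(fine (n == m)%:R%:E) -h; congr fine.
by apply: eq_integral => x _; rewrite hornerM.
Qed.

Lemma orthonormal_split n : exists2 rs : seq R, size rs = n &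
  p n = lead_coef (p n) *: \prod_(r <- rs) ('X - r%:P).
Proof.
have [szp [ledp _]] := op.
exact: (ortho_split HL Lpos (fun q => poly_bounded q cE) szp ledp Lort).
Qed.

Lemma orthonormal_lead_growth (I c : R) : min_energy E = I%:E -> expR (- I) < c ->
  exists2 K, 0 < K & forall n, (lead_coef (p n))^-1 <= K * c ^+ n.
Proof.
move=> EI Ic; have [szp [ledp _]] := op.
have [Q [mQ sQ QE]] := chebyshev_lt cE EI Ic.
have c0 : 0 < c by exact: lt_trans (expR_gt0 _) Ic.
apply: (ortho_lead_growth HL Lpos (fun q => poly_bounded q cE) szp ledp Lort c0 mQ sQ).
by move=> x Ex; exact/ltW/QE.
Qed.

Lemma orthonormal_markov n (t : R) : 0 < t ->
  (mu [set x | (t < `|(p n).[x]|)%R] <= (t ^- 2)%:E)%E.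
Proof.
move=> t0; have [_ [_ /(_ n n)]] := op; rewrite eqxx => h.
set A := [set x | _]; have mA : measurable A by exact: measurable_horner_gt.
have : ((t ^+ 2)%:E * mu A <= 1)%E.
  rewrite -h -integral_cst//.
  have mpp : measurable_fun [set: R] (fun x => ((p n).[x] * (p n).[x])%:E).
    by apply/measurable_EFinP; apply: measurable_funM; exact: measurable_horner.
  apply: (@le_trans _ _ (\int[mu]_(x in A) ((p n).[x] * (p n).[x])%:E)%E).
    apply: ge0_le_integral => //.
    - by move=> x _; rewrite lee_fin exprn_ge0// ltW.
    - exact: measurable_funTS.
    - move=> x /= tx; rewrite lee_fin -expr2 -[leRHS]real_normK ?num_real//.
      by rewrite lerXn2r ?nnegrE// ltW.
  apply: ge0_subset_integral => //.
  by move=> x _; rewrite lee_fin -expr2 sqr_ge0.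
rewrite -lee_pdivlMl ?exprn_gt0// mule1; exact.
Qed.

Lemma lower_growth_capacity0 (I B K0 : R) (n : nat -> nat) (rho : probability R R) :
  min_energy E = I%:E -> equilibrium E rho -> (forall j, (j <= n j)%N) ->
  zeros_weak_cvg (fun j => p (n j)) rho -> 0 < B -> B < expR (- I) -> 0 < K0 ->
  (forall N, exists2 j, (N <= j)%N & (lead_coef (p (n j)))^-1 <= K0 * B ^+ n j) ->
  exists X : set R, measurable X /\ X `<=` E /\ capacity X = 0%E /\ mu (~` X) = 0%E.
Proof.
move=> EI eqE jn zcv B0 BI K00 Jinf; have [szp [ledp _]] := op.
pose J j := (lead_coef (p (n j)))^-1 <= K0 * B ^+ n j.
(* Any rate strictly between [B] and the capacity would do. With [t = D / B], the bounds [t^n] on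
   [|p n|] and [K0 B^n] on the inverse leading coefficient multiply to [K0 D^n] for the monic
   polynomial. *)
pose D := (B + expR (- I)) / 2.
have BD : B < D by rewrite /D; lra.
have DI : D < expR (- I) by rewrite /D; lra.
have D0 : 0 < D by exact: lt_trans BD.
pose t := D / B; have t1 : 1 < t by rewrite /t ltr_pdivlMr// mul1r.
have t0 : 0 < t by exact: lt_trans t1.
pose A j := [set x | J j /\ t ^+ n j < `|(p (n j)).[x]| ].
pose X N := E `&` \bigcap_(j in [set j | (N <= j)%N]) ~` A j.
have cA j : closed (~` A j).
  have [Jj|/negbTE nJ] := boolP (J j); last first.
    have -> : A j = set0 by apply/seteqP; split => x // -[]; rewrite nJ.
    by rewrite setC0; exact: closedT.
  have -> : A j = [set x | t ^+ n j < `|(p (n j)).[x]|].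
    by apply/seteqP; split => x; [case|split].
  by rewrite setC_horner_gt; exact: closed_horner_le.
have cX N : closed (X N).
  by apply: closedI; [exact: compact_closed|exact: closed_bigI].
have XE N : X N `<=` E by move=> x [].
have mX N : measurable (X N) by exact: closed_measurable.
have mA j : measurable (A j).
  by rewrite -[A j]setCK; apply: measurableC; apply: closed_measurable; exact: cA.
have mUX : measurable (\bigcup_N X N) by exact: bigcup_measurable.
exists (\bigcup_N X N); split=> //; split; first by move=> x [N _]; exact: XE.
split.
  apply: capacity_eq0 => // nu nuX nufin.
  have [M M0 EM] := compact_diam cE.
  have [rs rsP] := choice (fun j => let: ex_intro2 s h1 h2 := orthonormal_split (n j) in
    ex_intro (fun s => size s = n j /\ p (n j) = lead_coef (p (n j)) *: \prod_(r <- s) ('X - r%:P))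
      s (conj h1 h2)).
  apply: (@finite_energy_contra R E M I D K0 rho nu (fun j => p (n j))
    (fun j => lead_coef (p (n j))) rs X J) => //.
  - by move=> j; rewrite gt_eqF.
  - by move=> j; have [] := rsP j.
  - by move=> j; have [-> _] := rsP j.
  - by move=> N x [Ex h]; split => // j /= Nj; apply: h; exact: ltnW.
  - by rewrite -ltr_expR lnK.
  - move=> N j x [Ex h] Nj Jj; have [sj pj] := rsP j.
    have k0 : 0 < lead_coef (p (n j)) by [].
    have : `|(p (n j)).[x]| <= t ^+ n j.
      by rewrite leNgt; apply/negP => h'; exact: (h j Nj).
    rewrite pj hornerZ horner_prod normrM normr_prod gtr0_norm// sj.
    under eq_bigr do rewrite hornerXsubC.
    rewrite mulrC -ler_pdivlMr// => /le_trans; apply.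
    rewrite mulrC (_ : D = B * t); last by rewrite /t mulrC divfK// gt_eqF.
    by rewrite [(B * t) ^+ _]exprMn mulrA; apply: ler_wpM2r => //; rewrite exprn_ge0// ltW.
(* Borel-Cantelli: [mu (A j)] is at most [t^(-2 n j) <= t^(-2 j)], as [j <= n j], the term of a
   convergent geometric series. *)
have hA : mu (lim_sup_set A) = 0%E.
  apply: lim_sup_set_cvg0 => //.
  have tz : t ^- 2 < 1 by rewrite invf_lt1 ?exprn_gt0// exprn_egt1.
  have hz : 0 < 1 - t ^- 2 by rewrite subr_gt0.
  apply: (@le_lt_trans _ _ ((1 - t ^- 2)^-1)%:E); last exact: ltry.
  apply: lime_le; first by apply: is_cvg_nneseries => k _ _.
  apply: nearW => m; apply: (@le_trans _ _ (\sum_(0 <= k < m) ((t ^- 2) ^+ k)%:E)%E).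
    apply: lee_sum => k _.
    apply: (@le_trans _ _ (mu [set x | (t ^+ n k < `|(p (n k)).[x]|)%R])).
      by apply: le_measure; rewrite ?inE//; [exact: measurable_horner_gt|move=> x []].
    apply: (le_trans (orthonormal_markov _ _)); first exact: exprn_gt0.
    rewrite lee_fin exprVn lef_pV2 ?posrE ?exprn_gt0// -!exprM mulnC.
    by apply: ler_weXn2l; [exact: ltW|rewrite leq_mul2r jn orbT].
  rewrite sumEFin lee_fin big_mkord.
  rewrite -(ler_pM2l hz) mulfV ?gt_eqF//.
  have := subrX1 (t ^- 2) m => h.
  have -> : (1 - t ^- 2) * (\sum_(i < m) (t ^- 2) ^+ i) = 1 - (t ^- 2) ^+ m.
    by rewrite -[LHS]opprK -mulNr opprB -h opprB.
  by rewrite gerBl exprn_ge0// invr_ge0 exprn_ge0// ltW.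
have mL : measurable (lim_sup_set A).
  apply: bigcap_measurable => [|k _]; first by exists 0%N.
  exact: bigcup_measurable.
apply: (@subset_measure0 _ _ _ mu _ (~` E `|` lim_sup_set A)).
- exact: measurableC.
- by apply: measurableU => //; exact: measurableC.
- move=> x nx; have [Ex|] := pselect (E x); last by left.
  right => N _; apply: contrapT => h; apply: nx; exists N => //; split => // j /= Nj Aj.
  by apply: h; exists j.
by apply: (etrans _ muE); apply: measureU0 => //; exact: measurableC.
Qed.

End Functional.

End RootAsymptotics.

Theorem theorem2 (R : realType) (mu : {finite_measure set R -> \bar R})
  (E : set R) (p : nat -> {poly R}) (a b : nat -> R)
  (n : nat -> nat) (rho : probability R R) :
  E = msupport mu -> compact E -> (0 < cap_compact E)%E ->
  orthonormal_polys mu p -> jacobi_params p a b ->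
  {homo n : i j / (i < j)%N} ->
  equilibrium E rho ->
  zeros_weak_cvg (fun j => p (n j)) rho ->
  ((fun j => ((\prod_(1 <= i < (n j).+1) a i) `^ ((n j)%:R^-1))%:E) @ \oo
      --> cap_compact E)
  \/ (exists X : set R, measurable X /\ X `<=` E /\
        capacity X = 0%E /\ mu (~` X) = 0%E).
Proof.
move=> ES cE capE op jp n_incr eqE zcv.
have muE : mu (~` E) = 0%E.
  by have := compact_measurable cE; rewrite ES; exact: msupport_null.
have [I EI ->] := cap_compact_fin cE capE eqE.
have [szp [ledp _]] := op.
have jn j : (j <= n j)%N by elim: j => // j IH; exact: leq_ltn_trans IH (n_incr _ _ _).
pose w j := \prod_(1 <= i < (n j).+1) a i.
pose k0 := lead_coef (p 0%N); have k00 : 0 < k0 by exact: ledp.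
have wE j : w j = k0 * (lead_coef (p (n j)))^-1.
  by rewrite /k0 -(jacobi_lead szp jp (n j)) mulrC mulKf// gt_eqF.
have w0 j : 0 <= w j by rewrite wE mulr_ge0 ?invr_ge0 ?ltW.
have [[B [/andP[B0 BI] hB]]|noB] := pselect (exists B, 0 < B < expR (- I) /\
    forall N, exists2 j, (N <= j)%N & w j `^ (n j)%:R^-1 <= B).
  right; apply: (lower_growth_capacity0 cE muE op EI eqE jn zcv B0 BI (K0 := k0^-1)).
    by rewrite invr_gt0.
  (* Starting from [N.+1] makes [n j] positive, as [root_le] requires. *)
  move=> N; have [j Nj] := hB N.+1.
  have n0 : (0 < n j)%N by rewrite (leq_trans _ (jn j))// (leq_trans _ Nj).
  rewrite root_le ?w0 ?(ltW B0)// wE => h; exists j; first exact: ltnW.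
  by rewrite mulrC ler_pdivlMr// mulrC.
left; apply: cvg_EFin; first exact: nearW.
apply/cvgrPdist_le => e e0.
have eI := expR_gt0 (- I).
have [N hN] : exists N, forall j, (N <= j)%N -> expR (- I) - e <= w j `^ (n j)%:R^-1.
  (* The second term keeps [B] positive when [e] is at least the capacity. *)
  pose B := Num.max (expR (- I) - e) (expR (- I) / 2).
  apply: contrapT => h; apply: noB; exists B; split.
    by rewrite lt_max gt_max; apply/andP; split; [apply/orP; right|apply/andP; split]; lra.
  move=> N; apply: contrapT => h'; apply: h; exists N => j Nj.
  rewrite leNgt; apply/negP => wlt; apply: h'; exists j => //.
  by rewrite le_max ltW.
have Ie : expR (- I) < expR (- I) + e / 2 by lra.
have [K K0 hK] := orthonormal_lead_growth cE muE op EI Ie.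
have up := @exp_root_le R w n (k0 * K) (expR (- I) + e / 2) (expR (- I) + e)
  (ltac:(lra)) (ltac:(lra)) (mulr_gt0 k00 K0) jn.
have {up}[|N' _ hN'] := up.
  by move=> j; rewrite w0 wE -mulrA ler_wpM2l ?(ltW k00).
exists (maxn N N') => // j /=; rewrite geq_max => /andP[Nj N'j].
have /= := hN' j N'j; have := hN j Nj; rewrite -/(w j) => h1 h2.
by rewrite ler_norml; apply/andP; split; lra.
Qed.
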